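(* Let $\tau$ be a semistandard Young tableau of shape $\lambda$ and weight $\mu$. Then $\mathring X_\tau$ has one irreducible component $\mathring X_\tau^{\mathrm{top}}$ of maximum dimension $\langle\lambda-\mu,\rho\rangle$.
   Context: All varieties are over $\mathbb C$. Fix integers $N\ge m\ge 1$ and partitions $\lambda=(\lambda_1\ge\dots\ge\lambda_m\ge 0)$ and $\mu=(\mu_1\ge\dots\ge\mu_m>0)$ of $N$. $\langle\ ,\ \rangle$ is the standard inner product on $\mathbb Z^m$ and $\rho=(m,m-1,\dots,1)$. $\mathbb O_\kappa$ denotes the conjugacy class of nilpotent matrices of Jordan type $\kappa$, and $\mathfrak n$ the space of strictly upper triangular $N\times N$ matrices. Denote the standard ordered basis of $\mathbb C^N$ by $(e_1^1,\dots,e_1^{\mu_1},\dots,e_m^1,\dots,e_m^{\mu_m})$. Let $J_\mu$ be the nilpotent Jordan matrix with $J_\mu e_a^b=e_a^{b-1}$ for $b>1$ and $J_\mu e_a^1=0$. $\mathbb T_\mu$ is the set of $A\in\mathfrak{gl}_N(\mathbb C)$ such that for all $1\le a,s\le m$, $1\le b\le\mu_a$, $1\le t\le\mu_s$: if $t<\mu_s$, or $t=\mu_s<b\le\mu_a$, then the $(e_s^t,e_a^b)$ entry of $A-J_\mu$ (row $e_s^t$, column $e_a^b$) is zero. A tableau of weight $\mu$ has $\mu_i$ entries equal to $i$. For $1\le i\le m$ let $\lambda^{(i)}$ be the shape of the tableau obtained from $\tau$ by deleting all entries $j>i$, and let $A_{(i)}$ be the upper left square submatrix of $A$ of size $\mu_1+\dots+\mu_i$.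 Then $\mathring X_\tau=\{A\in\mathbb T_\mu\cap\mathfrak n : A_{(i)}\in\mathbb O_{\lambda^{(i)}}\text{ for }1\le i\le m\}$. *)

(* Defs.v *)
From HB Require Import structures.
From mathcomp Require Import all_boot all_order all_algebra.
From mathcomp Require Import mpoly.
From mathcomp Require Import complex.
From mathcomp Require Import classical_sets reals.

Set Implicit Arguments.
Unset Strict Implicit.
Unset Printing Implicit Defensive.

Import Order.TTheory GRing.Theory Num.Theory.
Local Open Scope ring_scope.
Local Open Scope classical_set_scope.

(* Affine space of dimension N^2, with coordinates enumerated by mxvec. *)
Definition mxeval (F : fieldType) (N : nat) (p : {mpoly F[N * N]})
    (A : 'M[F]_N) : F :=
  p.@[fun k => mxvec A 0 k].

Definition zariski_closed (F : fieldType) (N : nat) (Z : set 'M[F]_N) : Prop :=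
  exists S : set {mpoly F[N * N]},
    Z = [set A | forall p, S p -> mxeval p A = 0].

Definition zariski_closed_in (F : fieldType) (N : nat)
    (X Z : set 'M[F]_N) : Prop :=
  exists2 C, zariski_closed C & Z = X `&` C.

(* Irreducibility of Z for the subspace topology: the relatively closed subsets
   of Z are the traces of closed sets. *)
Definition zariski_irreducible (F : fieldType) (N : nat)
    (Z : set 'M[F]_N) : Prop :=
  Z !=set0 /\
  forall C1 C2, zariski_closed C1 -> zariski_closed C2 ->
    Z `<=` C1 `|` C2 -> Z `<=` C1 \/ Z `<=` C2.

(* A maximal irreducible subset; it is automatically closed in X. *)
Definition irreducible_component (F : fieldType) (N : nat)
    (X Z : set 'M[F]_N) : Prop :=
  [/\ Z `<=` X, zariski_irreducible Z
    & forall Y, Y `<=` X -> zariski_irreducible Y -> Z `<=` Y -> Y = Z].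

(* c 0 < c 1 < ... < c d; the values of c beyond d are irrelevant. *)
Definition irreducible_chain (F : fieldType) (N : nat)
    (X : set 'M[F]_N) (d : nat) (c : nat -> set 'M[F]_N) : Prop :=
  (forall k, (k <= d)%N ->
     zariski_closed_in X (c k) /\ zariski_irreducible (c k)) /\
  (forall k, (k < d)%N -> c k `<` c k.+1).

Definition has_krull_dim (F : fieldType) (N : nat)
    (X : set 'M[F]_N) (d : nat) : Prop :=
  (exists c, irreducible_chain X d c) /\
  (forall e c, irreducible_chain X e c -> (e <= d)%N).

(* Trailing zero parts are allowed. *)
Definition is_partition (N : nat) (kappa : seq nat) : Prop :=
  sorted geq kappa /\ sumn kappa = N.

(* A tableau is the sequence of its rows, possibly with trailing empty rows;
   the weight is mu = (mu_1, ..., mu_m), where mu_i is nth 0 mu i.-1. *)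
Definition is_ssyt (lam mu : seq nat) (tau : seq (seq nat)) : Prop :=
  [/\ shape tau = lam,
      forall row x, row \in tau -> x \in row -> (1 <= x <= size mu)%N,
      forall row, row \in tau -> sorted leq row,
      forall r c, (r.+1 < size tau)%N -> (c < size (nth [::] tau r.+1))%N ->
        (nth 0 (nth [::] tau r) c < nth 0 (nth [::] tau r.+1) c)%N
    & forall i, (1 <= i <= size mu)%N ->
        count_mem i (flatten tau) = nth 0 mu i.-1]%N.

(* The shape lambda^(i) left after deleting the entries > i; emptied rows give
   trailing zero parts. *)
Definition tableau_shape (tau : seq (seq nat)) (i : nat) : seq nat :=
  shape [seq [seq x <- row | (x <= i)%N] | row <- tau].

(* <lambda - mu, rho> with rho = (m, m-1, ..., 1) *)
Definition pairing_rho (m : nat) (lam mu : m.-tuple nat) : int :=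
  \sum_(k < m) ((tnth lam k)%:Z - (tnth mu k)%:Z) * (m - k)%N%:Z.

(* The basis vector e_a^b is the one of 0-based rank k where
   reshape_index kappa k = a - 1 and reshape_offset kappa k = b - 1. *)
Definition jordan_mx (F : fieldType) (n : nat) (kappa : seq nat) : 'M[F]_n :=
  \matrix_(i, j)
    ((reshape_index kappa i == reshape_index kappa j) &&
     ((reshape_offset kappa i).+1 == reshape_offset kappa j))%:R.

(* The class O_kappa, for kappa a partition of n. *)
Definition nilp_orbit (F : fieldType) (n : nat) (kappa : seq nat) :
    set 'M[F]_n :=
  [set A | similar_in unitmx A (jordan_mx F n kappa)].

Definition strictly_upper (F : fieldType) (N : nat) : set 'M[F]_N :=
  [set A | forall i j : 'I_N, (j <= i)%N -> A i j = 0].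

Definition slice_T (F : fieldType) (N : nat) (mu : seq nat) : set 'M[F]_N :=
  [set A | forall i j : 'I_N,
     let s := reshape_index mu i in let t := (reshape_offset mu i).+1 in
     let a := reshape_index mu j in let b := (reshape_offset mu j).+1 in
     (t < nth 0 mu s)%N \/ (t = nth 0 mu s /\ nth 0 mu s < b <= nth 0 mu a)%N ->
     (A - jordan_mx F N mu) i j = 0].

(* The inequality under the existential holds whenever mu is a partition of N;
   it only serves to type the upper left submatrix A_(i). *)
Definition X_circ (F : fieldType) (N : nat) (mu : seq nat)
    (tau : seq (seq nat)) : set 'M[F]_N :=
  [set A | [/\ slice_T mu A, strictly_upper A
    & forall i, (1 <= i <= size mu)%N ->
        exists le_iN : (sumn (take i mu) <= N)%N,
          nilp_orbit (tableau_shape tau i)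
            (mxsub (widen_ord le_iN) (widen_ord le_iN) A)]].

(* Main.v *)
(* The set X_circ is itself irreducible. It is built one block at a time. Passing from
   A_(i) to A_(i+1) extends a nilpotent C[t]-module V by the cyclic module
   C[t]/(t^p), p = mu_(i+1), and the new columns of A only matter through a class v in
   V / t^p V, which depends linearly on them. The rank of the k-th power of the extension
   is governed by the least o >= k - p with t^o v in t^k V. Hence, in coordinates in which
   V is in Jordan form of type a = lambda^(i), the extension has type l = lambda^(i+1)
   exactly on an open subset of the linear space of those v whose component in the r-th
   Jordan block is divisible by t^(b_r), where b_r = sum_(j > r) (l_j - a_j).
   Jordan coordinates can be chosen polynomially near any given A_(i), so the fibres form
   locally an open subset of a vector bundle of rank i p - sum_r b_r. Starting from a
   point, one obtains a generically invertible, dominant parametrization of X_circ by an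
   open subset of an affine space; adding up the ranks gives the dimension
   <lambda - mu, rho>. *)

Require Import Defs.
From HB Require Import structures.
From mathcomp Require Import all_boot all_order all_algebra.
From mathcomp Require Import zify ring mpoly.
From mathcomp Require Import complex.
From mathcomp Require Import boolp classical_sets reals.

Set Implicit Arguments.
Unset Strict Implicit.
Unset Printing Implicit Defensive.

Import Order.TTheory GRing.Theory Num.Theory.
Local Open Scope ring_scope.
Local Open Scope classical_set_scope.

(** * Polynomial functions *)

(** Krull dimension is defined by chains, so both bounds are read off a parametrization directly.
    From below, freezing all but the first k coordinates gives nested irreducible subsets, and the
    rational inverse shows that they grow. From above one counts functions: a chain of length e
    supports s^e functions of degree O(s) that are linearly independent on its top, while their
    pullbacks lie in the space of polynomials of degree O(s) in d variables, of dimension O(s^d).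
    The obstacle in the induction over blocks is that Jordan coordinates exist only locally, whereas
    a chart is a single parametrization. Hence the linear conditions on v are stated without
    coordinates, as t^(a_r - b_r) v in t^(a_r) V; the local trivialization at one point yields the
    chart, and those at the other points serve to prove density. In families of matrices, adjugates
    replace inverses, which keeps the maps polynomial. Modules consist of row vectors, whence the
    transposes. *)

Section PolynomialFunctions.
Variables (F : fieldType) (T : Type) (n : nat) (c : T -> 'rV[F]_n).

(** The map [c] supplies the coordinates: it is the identity for row vectors and [mxvec] for
    matrices, so one calculus serves parametrizations, their inverses and composites. *)
Definition polyfun (f : T -> F) : Prop :=
  exists p : {mpoly F[n]}, forall t, f t = p.@[c t 0].

Definition polymap (a b : nat) (G : T -> 'M[F]_(a, b)) : Prop :=
  forall i j, polyfun (fun t => G t i j).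

Lemma eq_polyfun (f g : T -> F) : f =1 g -> polyfun f -> polyfun g.
Proof. by move=> fg [p fp]; exists p => t; rewrite -fg. Qed.

Lemma polyfun_const a : polyfun (fun=> a).
Proof. by exists a%:MP => t; rewrite mevalC. Qed.

Lemma polyfun_coord k : polyfun (fun t => c t 0 k).
Proof. by exists 'X_k => t; rewrite mevalXU. Qed.

Lemma polyfunD f g : polyfun f -> polyfun g -> polyfun (fun t => f t + g t).
Proof. by move=> [p fp] [q gq]; exists (p + q) => t; rewrite mevalD fp gq. Qed.

Lemma polyfunM f g : polyfun f -> polyfun g -> polyfun (fun t => f t * g t).
Proof. by move=> [p fp] [q gq]; exists (p * q) => t; rewrite mevalM fp gq. Qed.

Lemma polyfunN f : polyfun f -> polyfun (fun t => - f t).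
Proof. by move=> [p fp]; exists (- p) => t; rewrite mevalN fp. Qed.

Lemma polyfunB f g : polyfun f -> polyfun g -> polyfun (fun t => f t - g t).
Proof. by move=> fp gp; apply: polyfunD => //; apply: polyfunN. Qed.

Lemma polyfun_sum (I : Type) (r : seq I) (P : pred I) (h : I -> T -> F) :
  (forall i, polyfun (h i)) -> polyfun (fun t => \sum_(i <- r | P i) h i t).
Proof.
move=> hp; elim: r => [|i r IH].
  by apply: eq_polyfun (polyfun_const 0) => t; rewrite big_nil.
case Pi: (P i).
  by apply: eq_polyfun (polyfunD (hp i) IH) => t; rewrite big_cons Pi.
by apply: eq_polyfun IH => t; rewrite big_cons Pi.
Qed.

Lemma polyfun_prod (I : Type) (r : seq I) (P : pred I) (h : I -> T -> F) :
  (forall i, polyfun (h i)) -> polyfun (fun t => \prod_(i <- r | P i) h i t).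
Proof.
move=> hp; elim: r => [|i r IH].
  by apply: eq_polyfun (polyfun_const 1) => t; rewrite big_nil.
case Pi: (P i).
  by apply: eq_polyfun (polyfunM (hp i) IH) => t; rewrite big_cons Pi.
by apply: eq_polyfun IH => t; rewrite big_cons Pi.
Qed.

Lemma eq_polymap a b (G H : T -> 'M[F]_(a, b)) :
  G =1 H -> polymap G -> polymap H.
Proof. by move=> GH Gp i j; apply: eq_polyfun (Gp i j) => t; rewrite GH. Qed.

Lemma polymap_const a b (M : 'M[F]_(a, b)) : polymap (fun=> M).
Proof. by move=> i j; apply: polyfun_const. Qed.

Lemma polymapD a b (G H : T -> 'M[F]_(a, b)) :
  polymap G -> polymap H -> polymap (fun t => G t + H t).
Proof.
by move=> Gp Hp i j; apply: eq_polyfun (polyfunD (Gp i j) (Hp i j)) => t; rewrite mxE.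
Qed.

Lemma polymapN a b (G : T -> 'M[F]_(a, b)) :
  polymap G -> polymap (fun t => - G t).
Proof. by move=> Gp i j; apply: eq_polyfun (polyfunN (Gp i j)) => t; rewrite mxE. Qed.

Lemma polymapB a b (G H : T -> 'M[F]_(a, b)) :
  polymap G -> polymap H -> polymap (fun t => G t - H t).
Proof. by move=> Gp Hp; apply: polymapD => //; apply: polymapN. Qed.

Lemma polymapZ a b f (G : T -> 'M[F]_(a, b)) :
  polyfun f -> polymap G -> polymap (fun t => f t *: G t).
Proof. by move=> fp Gp i j; apply: eq_polyfun (polyfunM fp (Gp i j)) => t; rewrite mxE. Qed.

Lemma polymapM a b d (G : T -> 'M[F]_(a, b)) (H : T -> 'M[F]_(b, d)) :
  polymap G -> polymap H -> polymap (fun t => G t *m H t).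
Proof.
move=> Gp Hp i j; have := polyfun_sum (index_enum _) xpredT
  (fun k => polyfunM (Gp i k) (Hp k j)).
by apply: eq_polyfun => t; rewrite mxE.
Qed.

Lemma polymapX a (G : T -> 'M[F]_a) k : polymap G -> polymap (fun t => G t ^+ k).
Proof.
move=> Gp; elim: k => [|k IH]; first by apply: eq_polymap (polymap_const 1).
by apply: eq_polymap (polymapM Gp IH) => t; rewrite exprS.
Qed.

Lemma polymap_sum (I : Type) (r : seq I) (P : pred I) a b
    (h : I -> T -> 'M[F]_(a, b)) :
  (forall i, polymap (h i)) -> polymap (fun t => \sum_(i <- r | P i) h i t).
Proof.
move=> hp i j; apply: eq_polyfun (polyfun_sum r P (fun k => hp k i j)) => t.
by rewrite summxE.
Qed.

Lemma polymap_sub a b a' b' (u : 'I_a' -> 'I_a) (v : 'I_b' -> 'I_b)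
    (G : T -> 'M[F]_(a, b)) :
  polymap G -> polymap (fun t => mxsub u v (G t)).
Proof. by move=> Gp i j; apply: eq_polyfun (Gp (u i) (v j)) => t; rewrite mxE. Qed.

Lemma polymap_row a b b' (G : T -> 'M[F]_(a, b)) (H : T -> 'M[F]_(a, b')) :
  polymap G -> polymap H -> polymap (fun t => row_mx (G t) (H t)).
Proof.
move=> Gp Hp i j; case: (split_ordP j) => k ->.
  by apply: eq_polyfun (Gp i k) => t; rewrite row_mxEl.
by apply: eq_polyfun (Hp i k) => t; rewrite row_mxEr.
Qed.

Lemma polymap_vec a b (G : T -> 'rV[F]_(a * b)) :
  polymap G -> polymap (fun t => vec_mx (G t)).
Proof. by move=> Gp i j; apply: eq_polyfun (Gp 0 (mxvec_index i j)) => t; rewrite mxE. Qed.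

Lemma polymap_mxvec a b (G : T -> 'M[F]_(a, b)) :
  polymap G -> polymap (fun t => mxvec (G t)).
Proof.
move=> Gp i j; case/mxvec_indexP: j => k l.
by apply: eq_polyfun (Gp k l) => t; rewrite ord1 mxvecE.
Qed.

Lemma polyfun_det a (G : T -> 'M[F]_a) : polymap G -> polyfun (fun t => \det (G t)).
Proof.
move=> Gp; apply: polyfun_sum => s; apply: polyfunM; first exact: polyfun_const.
by apply: polyfun_prod => i; apply: Gp.
Qed.

Lemma polymap_adj a (G : T -> 'M[F]_a) : polymap G -> polymap (fun t => \adj (G t)).
Proof.
move=> Gp i j; have := polyfunM (polyfun_const ((-1) ^+ (j + i)))
  (polyfun_det (polymap_sub (lift j) (lift i) Gp)).
apply: eq_polyfun => t; rewrite mxE /cofactor; congr (_ * \det _).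
by apply/matrixP => k l; rewrite !mxE.
Qed.

End PolynomialFunctions.

Section PolynomialComposition.
Variables (F : fieldType) (T S : Type) (n k : nat).
Variables (c : T -> 'rV[F]_n) (e : S -> 'rV[F]_k).

Lemma polyfun_comp (f : T -> F) (h : S -> T) :
  polyfun c f -> polymap e (fun s => c (h s)) -> polyfun e (fun s => f (h s)).
Proof.
move=> [p fp] hp; suff : polyfun e (fun s => p.@[c (h s) 0]).
  by apply: eq_polyfun => s; rewrite fp.
have := polyfun_sum (msupp p) xpredT (fun m => polyfunM (polyfun_const e p@_m)
  (polyfun_prod (index_enum 'I_n) xpredT (fun i =>
    polyfun_prod (index_enum 'I_(m i)) xpredT (fun=> hp 0 i)))).
apply: eq_polyfun => s; rewrite mevalE; apply: eq_bigr => m _; congr (_ * _).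
by apply: eq_bigr => i _; rewrite prodr_const card_ord.
Qed.

Lemma polymap_comp a b (G : T -> 'M[F]_(a, b)) (h : S -> T) :
  polymap c G -> polymap e (fun s => c (h s)) -> polymap e (fun s => G (h s)).
Proof. by move=> Gp hp i j; apply: polyfun_comp (Gp i j) hp. Qed.

End PolynomialComposition.

Notation vpolyfun := (polyfun (@id _)).
Notation vpolymap := (polymap (@id _)).
Notation mpolyfun := (polyfun (@mxvec _ _ _)).
Notation mpolymap := (polymap (@mxvec _ _ _)).

Lemma mpolymap_id (F : fieldType) N : mpolymap (fun A : 'M[F]_N => A).
Proof.
move=> i j; apply: eq_polyfun (polyfun_coord (@mxvec F N N) (mxvec_index i j)) => A.
by rewrite mxvecE.
Qed.

Section Domain.
Variables (F : numFieldType) (d : nat).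

Lemma polyfun_line (f : 'rV[F]_d -> F) (a b : 'rV[F]_d) :
  vpolyfun f -> exists P : {poly F}, forall t, P.[t] = f (a + t *: b).
Proof.
move=> [p fp]; exists (\sum_(m <- msupp p)
   p@_m *: \prod_i ((a 0 i)%:P + b 0 i *: 'X) ^+ m i) => t.
rewrite fp mevalE horner_sum; apply: eq_bigr => m _.
rewrite hornerZ horner_prod; congr (_ * _); apply: eq_bigr => i _.
by rewrite horner_exp !hornerE !mxE mulrC.
Qed.

Lemma poly_nonroot (P : {poly F}) : P != 0 -> exists t, P.[t] != 0.
Proof.
move=> P0; set rs := [seq i%:R | i <- iota 0 (size P)] : seq F.
case: (boolP (all (root P) rs)) => [rP|].
  have u : uniq rs.
    by rewrite map_inj_uniq ?iota_uniq // => i j /eqP; rewrite eqr_nat => /eqP.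
  by have := max_poly_roots P0 rP u; rewrite size_map size_iota ltnn.
by move=> /allPn [t _ nt]; exists t.
Qed.

(** On the line through [x] and [y] both functions become nonzero polynomials in one variable, and
    their product has a non-root because the integers are distinct in [F]. *)
Lemma polyfun_domain (f g : 'rV[F]_d -> F) x y :
  vpolyfun f -> vpolyfun g -> f x != 0 -> g y != 0 -> exists z, f z != 0 /\ g z != 0.
Proof.
move=> fp gp fx gy.
have [P hP] := polyfun_line x (y - x) fp.
have [Q hQ] := polyfun_line x (y - x) gp.
have P0 : P != 0.
  by apply: contraNneq fx => P0; have := hP 0; rewrite P0 horner0 scale0r addr0 => <-.
have Q0 : Q != 0.
  apply: contraNneq gy => Q0; have := hQ 1.
  by rewrite Q0 horner0 scale1r subrKC => <-.
have /poly_nonroot [t] : P * Q != 0 by rewrite mulf_neq0.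
by rewrite hornerM hP hQ mulf_eq0 negb_or => /andP[]; exists (x + t *: (y - x)).
Qed.

Lemma polyfun_cancel (f g : 'rV[F]_d -> F) x :
  vpolyfun f -> vpolyfun g -> f x != 0 ->
  (forall z, f z != 0 -> g z = 0) -> forall z, g z = 0.
Proof.
move=> fp gp fx fg z; apply/eqP/negPn/negP => gz.
by have [t [ft]] := polyfun_domain fp gp fx gz; rewrite fg ?eqxx.
Qed.

End Domain.

(** * Charts, irreducibility and Krull dimension *)

Section Degree.
Variables (F : fieldType) (T : Type) (n : nat) (c : T -> 'rV[F]_n).

Definition polyfun_le (k : nat) (f : T -> F) : Prop :=
  exists2 p : {mpoly F[n]}, (msize p <= k.+1)%N & forall t, f t = p.@[c t 0].

Lemma polyfun_leW k f : polyfun_le k f -> polyfun c f.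
Proof. by case=> p _ fp; exists p. Qed.

Lemma polyfun_le_ex f : polyfun c f -> exists k, polyfun_le k f.
Proof. by move=> [p fp]; exists (msize p), p. Qed.

Lemma polyfun_le_trans k l f : (k <= l)%N -> polyfun_le k f -> polyfun_le l f.
Proof. by move=> kl [p pk fp]; exists p => //; apply: leq_trans pk _. Qed.

Lemma polyfun_le_const a : polyfun_le 0 (fun=> a).
Proof.
by exists a%:MP => [|t]; rewrite ?mevalC // mmeasureC; case: (a != 0).
Qed.

Lemma eq_polyfun_le k f g : f =1 g -> polyfun_le k f -> polyfun_le k g.
Proof. by move=> fg [p pk fp]; exists p => // t; rewrite -fg. Qed.

Lemma polyfun_leD k f g :
  polyfun_le k f -> polyfun_le k g -> polyfun_le k (fun t => f t + g t).
Proof.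
move=> [p pk fp] [q qk gq]; exists (p + q) => [|t]; last by rewrite mevalD fp gq.
by apply: leq_trans (mmeasureD_le _ _ _) _; rewrite geq_max pk qk.
Qed.

Lemma polyfun_leM k l f g :
  polyfun_le k f -> polyfun_le l g -> polyfun_le (k + l) (fun t => f t * g t).
Proof.
move=> [p pk fp] [q qk gq]; exists (p * q) => [|t]; last by rewrite mevalM fp gq.
have [-> | p0] := eqVneq p 0; first by rewrite mul0r mmeasure0.
have [-> | q0] := eqVneq q 0; first by rewrite mulr0 mmeasure0.
by rewrite msizeM // -ltnS; move: (leq_add pk qk); rewrite addSn addnS; case: (_ + _)%N.
Qed.

Lemma polyfun_leX k f m : polyfun_le k f -> polyfun_le (k * m) (fun t => f t ^+ m).
Proof.
move=> fk; elim: m => [|m IH]; first by rewrite muln0; apply: polyfun_le_const.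
by rewrite mulnS; apply: eq_polyfun_le (polyfun_leM fk IH) => t; rewrite exprS.
Qed.

Lemma polyfun_le_sum (I : Type) (r : seq I) k (h : I -> T -> F) :
  (forall i, polyfun_le k (h i)) -> polyfun_le k (fun t => \sum_(i <- r) h i t).
Proof.
move=> hp; elim: r => [|i r IH].
  apply: polyfun_le_trans (leq0n k) _.
  by apply: eq_polyfun_le (polyfun_le_const 0) => t; rewrite big_nil.
by apply: eq_polyfun_le (polyfun_leD (hp i) IH) => t; rewrite big_cons.
Qed.

Lemma polyfun_le_prod (I : Type) (r : seq I) (k : I -> nat) (h : I -> T -> F) :
  (forall i, polyfun_le (k i) (h i)) ->
  polyfun_le (\sum_(i <- r) k i) (fun t => \prod_(i <- r) h i t).
Proof.
move=> hp; elim: r => [|i r IH].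
  by rewrite big_nil; apply: eq_polyfun_le (polyfun_le_const 1) => t; rewrite big_nil.
by rewrite big_cons; apply: eq_polyfun_le (polyfun_leM (hp i) IH) => t; rewrite big_cons.
Qed.

End Degree.

(** [E] bounds the degrees of the coordinates of [h] and is the same for all [f]: composition
    multiplies degrees by at most a constant, on which the counting argument relies. *)
Lemma polyfun_le_comp (F : fieldType) (T S : Type) (n m : nat)
    (c : T -> 'rV[F]_n) (e : S -> 'rV[F]_m) (h : S -> T) :
  polymap e (fun s => c (h s)) -> exists E, forall k f,
    polyfun_le c k f -> polyfun_le e (k * E) (fun s => f (h s)).
Proof.
move=> hp; have /fin_all_exists [E hE] : forall i, exists k,
  polyfun_le e k (fun s => c (h s) 0 i) by move=> i; apply/polyfun_le_ex/hp.
exists (\max_i E i) => k f [p pk fp].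
suff : polyfun_le e (k * \max_i E i) (fun s => p.@[c (h s) 0]).
  by apply: eq_polyfun_le => s; rewrite fp.
(* The test on [mdeg m] discards nothing, since [p] has degree at most [k]; it bounds every summand
   without reference to its membership in the support. *)
suff : polyfun_le e (k * \max_i E i) (fun s => \sum_(m <- msupp p)
    if (mdeg m <= k)%N then p@_m * \prod_i c (h s) 0 i ^+ m i else 0).
  apply: eq_polyfun_le => s; rewrite mevalE !big_seq; apply: eq_bigr => a ap.
  by rewrite ifT // -ltnS (leq_trans (msize_mdeg_lt ap)).
apply: polyfun_le_sum => a; case ak: (mdeg a <= k)%N; last first.
  by apply: polyfun_le_trans (leq0n _) _; apply: polyfun_le_const.
rewrite -[(k * _)%N]add0n; apply: polyfun_leM; first exact: polyfun_le_const.
have := polyfun_le_prod (index_enum _) (fun i => polyfun_leX (a i) (hE i)).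
apply: polyfun_le_trans; apply: leq_trans (leq_mul ak (leqnn _)).
rewrite mdegE big_distrl /=; apply: leq_sum => i _; rewrite mulnC leq_mul //.
exact: leq_bigmax.
Qed.

Section Charts.
Variables (F : numFieldType) (N : nat).
Implicit Types X Z : set 'M[F]_N.

(* A dominant polynomial parametrization of X by a principal open subset of
   affine d-space, with a rational inverse pi / eta. *)
Definition rational_chart X (d : nat) : Prop :=
  exists (sigma : 'rV[F]_d -> 'M[F]_N) (f : 'rV[F]_d -> F)
         (eta : 'M[F]_N -> F) (pi : 'M[F]_N -> 'rV[F]_d),
    [/\ vpolymap sigma, vpolyfun f, mpolyfun eta & mpolymap pi] /\
    [/\ exists x, f x != 0,
        forall x, f x != 0 -> X (sigma x),
        forall x, f x != 0 ->
          eta (sigma x) != 0 /\ pi (sigma x) = eta (sigma x) *: x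
      & forall q, mpolyfun q -> (forall x, f x != 0 -> q (sigma x) = 0) ->
          forall A, X A -> q A = 0].

Lemma closed_zero (q : 'M[F]_N -> F) :
  mpolyfun q -> zariski_closed [set A | q A = 0].
Proof.
move=> [p qp]; exists [set p]; apply/seteqP; split=> A /= qA.
  by move=> _ ->; rewrite /mxeval -qp.
by rewrite qp; apply: qA.
Qed.

Lemma irreducible_mul Z (q1 q2 : 'M[F]_N -> F) :
  zariski_irreducible Z -> mpolyfun q1 -> mpolyfun q2 ->
  (forall A, Z A -> q1 A * q2 A = 0) ->
  (forall A, Z A -> q1 A = 0) \/ (forall A, Z A -> q2 A = 0).
Proof.
move=> [_ irr] q1p q2p q0.
apply: (irr _ _ (closed_zero q1p) (closed_zero q2p)) => A /q0 /eqP.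
by rewrite mulf_eq0 => /orP[] /eqP; [left|right].
Qed.

Lemma closed_separate C A : zariski_closed C -> ~ C A ->
  exists q : 'M[F]_N -> F,
    [/\ mpolyfun q, forall B, C B -> q B = 0 & q A != 0].
Proof.
move=> [S ->] /existsNP [p /not_implyP [Sp pA]].
exists (mxeval p); split; [by exists p | by move=> B; apply | exact/eqP].
Qed.

(** Equations of [C1] and [C2] that fail somewhere on [Z] pull back to nonzero polynomials; together
    with [f] they are nonzero at a common parameter, whose image lies in neither set. The form of
    the statement covers the truncated parametrizations of [chart_chain]. *)
Lemma irreducible_param d Z (sigma : 'rV[F]_d -> 'M[F]_N) (f : 'rV[F]_d -> F) :
  vpolymap sigma -> vpolyfun f -> (exists x, f x != 0) ->
  (forall x, f x != 0 -> Z (sigma x)) ->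
  (forall q, mpolyfun q -> (forall x, f x != 0 -> q (sigma x) = 0) ->
     forall A, Z A -> q A = 0) ->
  zariski_irreducible Z.
Proof.
move=> sp fp [x0 fx0] Zs dens; split; first by exists (sigma x0); apply: Zs.
move=> C1 C2 C1c C2c ZC; apply/or_asboolP/negPn/negP.
rewrite negb_or => /andP[/asboolPn nC1 /asboolPn nC2].
have sep C : zariski_closed C -> ~ Z `<=` C -> exists q x,
    [/\ mpolyfun q, forall B, C B -> q B = 0 & f x != 0 /\ q (sigma x) != 0].
  move=> Cc /existsNP [A /not_implyP [ZA nCA]].
  have [q [qp qC qA]] := closed_separate Cc nCA.
  have /existsNP [x /not_implyP [fx /eqP qx]] :
      ~ forall x, f x != 0 -> q (sigma x) = 0.
    by move=> /(dens q qp)/(_ A ZA)/eqP; rewrite (negPf qA).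
  by exists q, x.
have [q1 [x1 [q1p q1C [_ q1x]]]] := sep _ C1c nC1.
have [q2 [x2 [q2p q2C [_ q2x]]]] := sep _ C2c nC2.
have p1 := polyfun_comp q1p (polymap_mxvec sp).
have p2 := polyfun_comp q2p (polymap_mxvec sp).
have [y [fy qy]] := polyfun_domain fp p1 fx0 q1x.
have [z [/[!mulf_eq0]/[!negb_or]/andP[fz q1z] q2z]] :
    exists z, f z * q1 (sigma z) != 0 /\ q2 (sigma z) != 0.
  exact: (polyfun_domain (polyfunM fp p1) p2 (mulf_neq0 fy qy) q2x).
by case: (ZC _ (Zs z fz)) => [/q1C|/q2C] /eqP; apply/negP.
Qed.

Lemma chart_irreducible X d : rational_chart X d -> zariski_irreducible X.
Proof.
move=> [sigma [f [eta [pi [[sp fp _ _] [f0 Xs _ dens]]]]]].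
exact: irreducible_param sp fp f0 Xs dens.
Qed.

Definition vanishing_closure (S : set 'M[F]_N) : set 'M[F]_N :=
  [set A | forall p, (forall B, S B -> mxeval p B = 0) -> mxeval p A = 0].

Lemma vanishing_closure_closed S : zariski_closed (vanishing_closure S).
Proof.
exists [set p | forall B, S B -> mxeval p B = 0].
by apply/seteqP; split.
Qed.

Lemma sub_vanishing_closure S : S `<=` vanishing_closure S.
Proof. by move=> A SA p; apply. Qed.

Lemma chart_chain X d : rational_chart X d -> exists c, irreducible_chain X d c.
Proof.
move=> [sigma [f [eta [pi [[sp fp etap pip] [[x0 fx0] Xs inv dens]]]]]].
(* Coordinates from [k] on are frozen at those of [x0], not at 0, so that [f] is nonzero somewhere
   on every truncation. *)
pose tr k (x : 'rV[F]_d) := \row_i (if (i < k)%N then x 0 i else x0 0 i).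
have trp k : vpolymap (tr k).
  move=> i j; rewrite (ord1 i); case jk: (j < k)%N.
    by apply: eq_polyfun (polyfun_coord _ j) => x; rewrite mxE jk.
  by apply: eq_polyfun (polyfun_const _ (x0 0 j)) => x; rewrite mxE jk.
have tr0 k : tr k x0 = x0 by apply/rowP => i; rewrite mxE if_same.
pose S k := [set A | exists2 x, f (tr k x) != 0 & A = sigma (tr k x)].
have Sc k : forall A, S k A -> (X `&` vanishing_closure (S k)) A.
  move=> A SA; split; last exact: sub_vanishing_closure.
  by case: SA => x fx ->; apply: Xs.
exists (fun k => X `&` vanishing_closure (S k)); split=> k kd.
  split; first by exists (vanishing_closure (S k)) => //; apply: vanishing_closure_closed.
  apply: (@irreducible_param d _ (fun x => sigma (tr k x)) (fun x => f (tr k x))).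
  - exact: polymap_comp sp (trp k).
  - exact: polyfun_comp fp (trp k).
  - by exists x0; rewrite tr0.
  - by move=> x fx; apply: Sc; exists x.
  - move=> q [p qp] q0 A [_ /(_ p)]; rewrite /mxeval -qp; apply.
    by move=> _ [x fx ->]; rewrite -qp q0.
split=> [A [XA clA]|sub].
  split=> // p pS; apply: clA => _ [x fx ->]; apply: pS.
  have trE : tr k.+1 (tr k x) = tr k x.
    apply/rowP => i; rewrite !mxE; case: (ltnP i k) => ik; last by rewrite if_same.
    by rewrite ltnS ltnW.
  by exists (tr k x); rewrite trE.
pose j := Ordinal kd.
have [z [fz zj]] : exists z, f (tr k.+1 z) != 0 /\ z 0 j - x0 0 j != 0.
  apply: (@polyfun_domain _ _ _ _ x0 (x0 + const_mx 1)).
  - exact: polyfun_comp fp (trp _).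
  - by apply: polyfunB; [apply: polyfun_coord|apply: polyfun_const].
  - by rewrite tr0.
  - by rewrite !mxE [x0 0 j + 1]addrC addrK oner_eq0.
have [eta0 piE] := inv _ fz.
(* Cleared of its denominator, this measures how far coordinate [j] of the parameter is from its
   frozen value; it vanishes on [S k] but not at the point given by [z]. *)
have qp : mpolyfun (fun A => pi A 0 j - eta A * x0 0 j).
  apply: polyfunB; first exact: pip.
  by apply: polyfunM => //; apply: polyfun_const.
case: qp => p qp.
have /sub [_ /(_ p)] : (X `&` vanishing_closure (S k.+1)) (sigma (tr k.+1 z)).
  by apply: Sc; exists z.
rewrite /mxeval -qp => q0; have := mulf_neq0 eta0 zj; move/eqP; apply.
rewrite -[RHS]q0; first by rewrite piE !mxE /= ltnSn mulrBr.
move=> _ [x fx ->]; rewrite -qp; have [_ ->] := inv _ fx.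
by rewrite !mxE /= ltnn subrr.
Qed.

(* If f vanishes on c e but not on c e.+1, then functions that are linearly
   independent on c e stay so on c e.+1 after multiplication by the powers of f. *)
Lemma chain_independent X e c : irreducible_chain X e c ->
  exists D, forall s, exists (T : finType) (g : T -> 'M[F]_N -> F),
    [/\ #|T| = (s ^ e)%N, forall t, polyfun_le (@mxvec _ _ _) (D * s) (g t)
      & forall a : T -> F, (forall A, c e A -> \sum_t a t * g t A = 0) ->
          forall t, a t = 0].
Proof.
elim: e => [|e IH] [Xc ltc].
  exists 0%N => s; exists unit, (fun _ _ => 1); split=> [|t|a].
  - by rewrite card_unit.
  - by rewrite mul0n; apply: polyfun_le_const.
  have [_ [[A cA] _]] := Xc 0%N isT.
  move=> /(_ A cA); rewrite (big_pred1 tt) ?mulr1; last by case.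
  by move=> + [].
have [|D hD] := IH; first by split=> k ke; [apply: Xc|apply: ltc]; apply: leqW.
have [lec nec] := ltc e (ltnSn e).
have [[C0 C0c cE0] _] := Xc e (leqnSn _); have [_ irr] := Xc e.+1 (leqnn _).
have [A [cA ncA]] : exists A, c e.+1 A /\ ~ C0 A.
  move/existsNP: nec => [A /not_implyP [cA ncA]]; exists A; split=> // C0A.
  have [[C1 _ cE1] _] := Xc e.+1 (leqnn _).
  by apply: ncA; rewrite cE0; split=> //; move: cA; rewrite cE1 => -[].
have [f [fp f0 fA]] := closed_separate C0c ncA.
have [D1 fD1] := polyfun_le_ex fp.
exists (D1 + D)%N => s; have [T [g [cT gD gi]]] := hD s.
exists ('I_s * T)%type, (fun (t : 'I_s * T) B => f B ^+ t.1 * g t.2 B); split.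
- by rewrite card_prod card_ord cT expnS.
- move=> [i t]; rewrite mulnDl; apply: polyfun_leM (gD t).
  by apply: polyfun_le_trans (polyfun_leX i fD1); rewrite leq_mul // ltnW.
(* Once the coefficients of the lower powers vanish, the relation reads f^i h = 0. Irreducibility of
   [c e.+1] cancels f^i, and on [c e], where f = 0, only the terms with exponent [i] remain in
   [h]. *)
move=> a a0 [i t]; have [k ik] := ubnP i; elim: k i ik t => // k IHk i ik.
pose h B := \sum_(j : 'I_s) \sum_t (if (i <= j)%N then a (j, t) else 0) *
  (f B ^+ (j - i) * g t B).
have gp t : mpolyfun (g t) by apply: polyfun_leW (gD t).
have fXp l : mpolyfun (fun B => f B ^+ l).
  by have [? ?] := polyfun_le_ex fp; apply: polyfun_leW (polyfun_leX _ _); eassumption.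
have hp : mpolyfun h.
  apply: polyfun_sum => j; apply: polyfun_sum => t.
  by apply: polyfunM; [apply: polyfun_const|apply: polyfunM].
have hE B : f B ^+ i * h B = \sum_t a t * (f B ^+ t.1 * g t.2 B).
  transitivity (\sum_(j : 'I_s) \sum_t a (j, t) * (f B ^+ j * g t B)); last first.
    by rewrite pair_bigA; apply: eq_bigr => -[].
  rewrite mulr_sumr; apply: eq_bigr => j _; rewrite mulr_sumr; apply: eq_bigr => t _.
  case: leqP => ij; first by rewrite mulrCA (mulrA (f B ^+ i)) -exprD subnKC.
  by rewrite (IHk j) ?mul0r ?mulr0 //; apply: leq_trans ij _.
have h0 B : c e.+1 B -> h B = 0.
  have := @irreducible_mul _ _ h irr (fXp i) hp; case=> [C cC|f0'|]; last exact.
    by rewrite hE a0.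
  by move: (f0' A cA) => /eqP; rewrite expf_eq0 (negPf fA) andbF.
apply: gi => B cB; rewrite -[RHS](h0 B); last exact: lec.
rewrite /h (bigD1 i) //= leqnn subnn [X in _ + X]big1 ?addr0 => [|j ji].
  by apply: eq_bigr => t _; rewrite expr0 mul1r.
apply: big1 => t _; case: leqP => ij; last by rewrite mul0r.
have /f0 -> : C0 B by move: cB; rewrite cE0 => -[].
by rewrite expr0n subn_eq0 leqNgt ltn_neqAle ij eq_sym ji mul0r mulr0.
Qed.

Lemma card_bmultinom_le d k : (#|{: 'X_{1..d < k}}| <= k ^ d)%N.
Proof.
rewrite -[X in (X ^ d)%N]card_ord -[d in (_ ^ d)%N]card_ord -card_ffun.
have lt_mk (m : 'X_{1..d < k}) i : (m i < k)%N.
  by apply: leq_ltn_trans (bmdeg m); rewrite mdegE (bigD1 i) //= leq_addr.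
pose u (m : 'X_{1..d < k}) := [ffun i => Ordinal (lt_mk m i)].
apply: (@leq_card _ _ u) => m1 m2 /ffunP um; apply/val_inj/mnmP => i.
by have := congr1 val (um i); rewrite !ffunE.
Qed.

Lemma chart_chain_le X d e c :
  rational_chart X d -> irreducible_chain X e c -> (e <= d)%N.
Proof.
move=> [sigma [f [eta [pi [[sp fp _ _] [[x0 fx0] _ _ dens]]]]]] Xc.
rewrite leqNgt; apply/negP => de.
have [D hD] := chain_independent Xc.
have [E hE] := polyfun_le_comp (polymap_mxvec sp).
(* At most (K s + 1)^d <= (K + 1)^d s^d monomials have degree at most K s; this [s] makes that
   number smaller than s^(d+1), hence smaller than the number s^e of functions. *)
pose K := (D * E)%N; pose s := ((K.+1 ^ d).+1)%N.
have [T [g [cT gD gi]]] := hD s.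
have Xce A : c e A -> X A by have [[C _ ->] _] := Xc.1 e (leqnn e); case.
have /fin_all_exists [p pP] t : exists p : {mpoly F[d]},
    (msize p <= (K * s).+1)%N /\ forall x, g t (sigma x) = p.@[x 0].
  have [p pk pE] := hE _ _ (gD t); exists p; split=> //.
  by rewrite mulnAC.
pose b := (K * s).+1.
(* The rows are the coefficient vectors of the pulled back functions. A vector of the left kernel is
   a linear relation on the image of [sigma], hence on [X] by density. *)
pose M : 'M[F]_(#|T|, #|{: 'X_{1..d < b}}|) :=
  \matrix_(i, j) (p (enum_val i))@_(enum_val j : 'X_{1..d < b}).
have : ~~ row_free M.
  rewrite -row_leq_rank -ltnNge; apply: leq_ltn_trans (rank_leq_col M) _.
  apply: leq_ltn_trans (card_bmultinom_le _ _) _; rewrite cT.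
  apply: (@leq_trans (s ^ d.+1)%N); last by rewrite leq_pexp2l.
  apply: (@leq_ltn_trans ((K.+1 * s) ^ d)%N); last by rewrite expnMn expnS ltn_pmul2r // expn_gt0.
  by case: (d) => // d'; rewrite leq_exp2r // /b mulSn -addn1 addnC leq_add2r.
rewrite -kermx_eq0 => /rowV0Pn [v /sub_kermxP vM v0].
have : forall t, v 0 (enum_rank t) = 0.
  apply: (gi (fun t => v 0 (enum_rank t))) => A /Xce; move: A.
  apply: (dens (fun A => \sum_t v 0 (enum_rank t) * g t A)).
    apply: polyfun_sum => t; apply: polyfunM; first exact: polyfun_const.
    exact: polyfun_leW (gD t).
  move=> x _; under eq_bigr do rewrite (pP _).2 -mevalZ.
  rewrite -(raddf_sum (meval (x 0))) /=.
  have -> : \sum_t v 0 (enum_rank t) *: p t = 0; last by rewrite meval0.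
  apply/mpolyP => m; rewrite mcoeff0 raddf_sum /=.
  case: (ltnP (mdeg m) b) => mb.
    have := congr1 (fun w : 'rV_ _ => w 0 (enum_rank (BMultinom mb))) vM.
    rewrite !mxE => vM0; rewrite -[RHS]vM0 [RHS](reindex (@enum_rank T)) /=; last first.
      exact: onW_bij (@enum_rank_bij T).
    by apply: eq_bigr => t _; rewrite mxE mcoeffZ !enum_rankK.
  apply: big1 => t _; rewrite mcoeffZ (memN_msupp_eq0 _) ?mulr0 //.
  by apply: msize_mdeg_ge; apply: leq_trans mb; have [] := pP t.
by move=> v00; case/eqP: v0; apply/rowP => i; rewrite mxE -(enum_valK i) v00.
Qed.

Lemma chart_krull_dim X d : rational_chart X d -> has_krull_dim X d.
Proof.
move=> Xd; split; first exact: chart_chain.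
by move=> e c; apply: chart_chain_le.
Qed.

End Charts.

(** * Open subsets of vector bundles *)

Section LocalKernel.
Variables (F : fieldType) (a b : nat).
Implicit Types M : 'M[F]_(a, b).

Lemma rank_factorization r M : \rank M = r -> exists (C : 'M_(a, r)) (R : 'M_(r, b)),
  [/\ C *m R = M, row_full C & row_free R].
Proof.
move=> <-; exists (col_base M), (row_base M).
by rewrite mulmx_base col_base_full row_base_free.
Qed.

(* When U *m M *m V is invertible of size the rank of M, its kernel projector
   up to the scalar \det (U *m M *m V); no inverse occurs, so it is polynomial in M. *)
Definition kernel_adj r (U : 'M[F]_(r, a)) (V : 'M[F]_(b, r)) M : 'M[F]_a :=
  (\det (U *m M *m V))%:M - M *m V *m \adj (U *m M *m V) *m U.

Lemma kernel_adj_id r (U : 'M_(r, a)) (V : 'M_(b, r)) M (x : 'rV_a) :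
  x *m M = 0 -> x *m kernel_adj U V M = \det (U *m M *m V) *: x.
Proof.
by move=> xM; rewrite mulmxBr !mulmxA xM !mul0mx subr0 mul_mx_scalar.
Qed.

(* With M = C R a rank factorization, U C and R V are invertible. *)
Lemma kernel_adjM r (U : 'M_(r, a)) (V : 'M_(b, r)) M :
  \rank M = r -> \det (U *m M *m V) != 0 -> kernel_adj U V M *m M = 0.
Proof.
move=> rM D0; have [C [R [ME _ _]]] := rank_factorization rM.
have Du : U *m M *m V \in unitmx by rewrite unitmxE unitfE.
rewrite /kernel_adj; set D := U *m M *m V in D0 Du *.
have DE : D = (U *m C) *m (R *m V) by rewrite /D -ME !mulmxA.
have /andP[CU RU] : (U *m C \in unitmx) && (R *m V \in unitmx).
  by rewrite -unitmx_mul -DE.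
have RVD : R *m V *m \adj D *m (U *m C) = (\det D)%:M.
  apply: (row_free_inj (A := R *m V)); first by rewrite row_free_unit.
  by rewrite /= -mulmxA -DE -mulmxA mul_adj_mx mul_mx_scalar mul_scalar_mx.
rewrite mulmxBl mul_scalar_mx; apply/eqP; rewrite subr_eq0; apply/eqP.
transitivity (C *m (R *m V *m \adj D *m (U *m C)) *m R).
  by rewrite RVD mul_mx_scalar -scalemxAl ME.
by rewrite -[in RHS]ME !mulmxA.
Qed.

Section PolynomialFamily.
Variables (T : Type) (n : nat) (c : T -> 'rV[F]_n) (M : T -> 'M[F]_(a, b)).
Hypothesis Mp : polymap c M.

Lemma polyfun_kernel_det r (U : 'M_(r, a)) (V : 'M_(b, r)) :
  polyfun c (fun t => \det (U *m M t *m V)).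
Proof.
apply: polyfun_det; apply: polymapM; last exact: polymap_const.
by apply: polymapM => //; apply: polymap_const.
Qed.

Lemma polymap_kernel_adj r (U : 'M_(r, a)) (V : 'M_(b, r)) :
  polymap c (fun t => kernel_adj U V (M t)).
Proof.
apply: polymapB.
  apply: eq_polymap (polymapZ (polyfun_kernel_det U V) (polymap_const c 1%:M)) => t.
  by rewrite scalemx1.
have UMp : polymap c (fun t => U *m M t *m V).
  apply: polymapM; last exact: polymap_const.
  by apply: polymapM => //; apply: polymap_const.
apply: polymapM; last exact: polymap_const.
by apply: polymapM; [apply: polymapM => //; apply: polymap_const | apply: polymap_adj].
Qed.

(** [U] and [V] are chosen to make [U *m M t0 *m V] the identity. With the rank constant,
    [kernel_adj] is a multiple of a projector onto the kernel of [M t] as long as the determinant is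
    nonzero, and it moves [x0] into that kernel polynomially in [t]. *)
Lemma kernel_section (Y : T -> Prop) r t0 (x0 : 'rV[F]_a) :
  (forall t, Y t -> \rank (M t) = r) -> Y t0 -> x0 *m M t0 = 0 ->
  exists (x : T -> 'rV[F]_a) (delta : T -> F),
    [/\ polymap c x, polyfun c delta, x t0 = x0, delta t0 != 0
      & forall t, Y t -> delta t != 0 -> x t *m M t = 0].
Proof.
move=> rM Yt0 xM0.
have [U [V D1]] : exists (U : 'M_(r, a)) (V : 'M_(b, r)), U *m M t0 *m V = 1%:M.
  have [C [R [<- /row_fullP[U UC] /row_freeP[V RV]]]] := rank_factorization (rM _ Yt0).
  by exists U, V; rewrite mulmxA UC mul1mx.
exists (fun t => x0 *m kernel_adj U V (M t)), (fun t => \det (U *m M t *m V)).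
split.
- by apply: polymapM; [apply: polymap_const | apply: polymap_kernel_adj].
- exact: polyfun_kernel_det.
- by rewrite kernel_adj_id // D1 det1 scale1r.
- by rewrite D1 det1 oner_eq0.
- by move=> t Yt dt; rewrite -mulmxA kernel_adjM ?mulmx0 // rM.
Qed.

End PolynomialFamily.
End LocalKernel.

Lemma exists_poly_nonzero (F : numFieldType) (N d : nat) (Y : set 'M[F]_N)
    (sigma : 'rV[F]_d -> 'M[F]_N) (f : 'rV[F]_d -> F) (q : 'M[F]_N -> F) B :
  (forall q, mpolyfun q -> (forall x, f x != 0 -> q (sigma x) = 0) ->
    forall A, Y A -> q A = 0) ->
  mpolyfun q -> Y B -> q B != 0 -> exists x, f x != 0 /\ q (sigma x) != 0.
Proof.
move=> dens qp YB qB; apply/not_existsP => nx; case/eqP: qB; apply: dens YB => // x fx.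
by apply/eqP/negPn/negP => qx; apply: (nx x).
Qed.

Section Bundle.
Variables (F : numFieldType) (N b c d : nat) (Y E : set 'M[F]_N).
Variables (ret : 'M[F]_N -> 'M[F]_N) (wco : 'M[F]_N -> 'rV[F]_b).
Variables (emb : 'M[F]_N -> 'rV[F]_b -> 'M[F]_N).
Variable (L : 'M[F]_N -> 'rV[F]_b -> Prop).
Hypothesis retp : mpolymap ret.
Hypothesis wcop : mpolymap wco.
Hypothesis embp : forall (S : Type) (n : nat) (e : S -> 'rV[F]_n) B w,
  polymap e B -> polymap e w -> polymap e (fun s => emb (B s) (w s)).
Hypothesis retE : forall A, E A ->
  [/\ Y (ret A), L (ret A) (wco A) & emb (ret A) (wco A) = A].
Hypothesis embK : forall B w, Y B -> ret (emb B w) = B /\ wco (emb B w) = w.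
Hypothesis local : forall B0, Y B0 -> exists
    (delta : 'M[F]_N -> F) (M : 'M[F]_N -> 'M[F]_(b, c)) (g : 'M[F]_N -> F) w1,
  [/\ mpolyfun delta, mpolymap M, mpolyfun g & delta B0 != 0] /\
  [/\ forall B, Y B -> delta B != 0 -> \rank (M B) = c,
      forall B w, Y B -> delta B != 0 -> (L B w <-> w *m M B = 0),
      L B0 w1 /\ g (emb B0 w1) != 0
    & forall B w, Y B -> delta B != 0 -> L B w -> g (emb B w) != 0 -> E (emb B w)].

(** [L] is a vector bundle over [Y], locally the kernel of [M]; [E] lies in it and contains a
    nonempty open part of it near every base point. The chart of [E] combines that of [Y] with a
    polynomial frame of the kernel near [B0]. *)
Lemma bundle_chart : rational_chart Y d -> rational_chart E (d + (b - c)).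
Proof.
move=> [sigma [f [eta [pi [[sp fp etap pip] [[x0 fx0] Xs inv dens]]]]]].
have [delta [M [g [w1 [[dp Mp gp dB0] [rM LM [Lw1 gw1] gE]]]]]] := local (Xs _ fx0).
set B0 := sigma x0 in dB0 Lw1 gw1.
have rM0 := rM _ (Xs _ fx0) dB0; rewrite -/B0 in rM0.
have [U UM0] : exists U, U *m M B0 = 1%:M.
  by apply/row_fullP; rewrite /row_full rM0.
have [r [W0 [rE W0free W0E]]] : exists r (W0 : 'M_(r, b)),
    [/\ (b - c)%N = r, row_free W0 & (W0 :=: kermx (M B0))%MS].
  exists (\rank (kermx (M B0))), (row_base (kermx (M B0))).
  split; [by have := mxrank_ker (M B0); rewrite rM0 | exact: row_base_free | exact: eq_row_base].
rewrite {}rE.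
have W0M : W0 *m M B0 = 0.
  by apply/eqP; rewrite -sub_kermx W0E.
(* Every [w] splits as [(w *m M B0) *m U + (w *m G) *m W0]: [G] reads off the coordinates of the
   kernel component in the basis [W0]. *)
have [G GE] : exists G, 1%:M - M B0 *m U = G *m W0.
  apply/submxP; rewrite W0E sub_kermx mulmxBl mul1mx -mulmxA UM0 mulmx1.
  by rewrite subrr.
have UG : U *m G = 0.
  apply: (row_free_inj W0free); rewrite -mulmxA -GE mulmxBr mulmx1 mulmxA UM0 mul1mx.
  by rewrite subrr mul0mx.
have W0G : W0 *m G = 1%:M.
  apply: (row_free_inj W0free); rewrite -mulmxA -GE mulmxBr mulmx1 mulmxA W0M mul0mx.
  by rewrite subr0 mul1mx.
(* [M B] has as many columns as its rank [c], so the right factor can be the identity. *)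
pose D B := \det (U *m M B *m 1%:M); pose K B := kernel_adj U 1%:M (M B).
have Dp : mpolyfun D by apply: polyfun_kernel_det.
have Kp : mpolymap K by apply: polymap_kernel_adj.
have D1 : D B0 = 1 by rewrite /D mulmx1 UM0 det1.
have KM B : Y B -> delta B != 0 -> D B != 0 -> K B *m M B = 0.
  by move=> YB dB DB; apply: kernel_adjM => //; apply: rM.
(* Where [D B] is nonzero, the rows of [W0 *m K B] form a frame of the kernel of [M B], and [G]
   recovers coordinates in it up to the factor [D B]. *)
have WKG B : W0 *m K B *m G = (D B)%:M.
  rewrite /K /kernel_adj -/(D B) mulmxBr mulmxBl -!mulmxA UG !mulmx0 subr0.
  by rewrite mul_scalar_mx -scalemxAr W0G scalemx1.
have UK B : U *m K B = 0.
  rewrite /K /kernel_adj !mulmx1 mulmxBr !mulmxA mul_mx_adj mul_scalar_mx mul_mx_scalar.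
  by rewrite subrr.
have ker_param B (w : 'rV_b) : w *m M B = 0 -> D B *: w = (w *m G) *m (W0 *m K B).
  move=> wM; rewrite -(kernel_adj_id U 1%:M wM) -/(K B).
  have {1}-> : w = w *m M B0 *m U + w *m G *m W0.
    by rewrite -[w *m G *m W0]mulmxA -GE mulmxBr mulmx1 mulmxA addrC subrK.
  by rewrite mulmxDl -[w *m _ *m U *m _]mulmxA UK mulmx0 add0r !mulmxA.
pose par B (y : 'rV_r) : 'rV_b := y *m (W0 *m K B).
have parM B y : Y B -> delta B != 0 -> D B != 0 -> L B (par B y).
  by move=> YB dB DB; apply/LM => //; rewrite /par -!mulmxA KM ?mulmx0.
pose sigma' (z : 'rV[F]_(d + r)) := emb (sigma (lsubmx z)) (par (sigma (lsubmx z)) (rsubmx z)).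
have lp : vpolymap (fun z : 'rV[F]_(d + r) => lsubmx z).
  by move=> i j; apply: eq_polyfun (polyfun_coord _ (lshift r j)) => z; rewrite mxE (ord1 i).
have rp : vpolymap (fun z : 'rV[F]_(d + r) => rsubmx z).
  by move=> i j; apply: eq_polyfun (polyfun_coord _ (rshift d j)) => z; rewrite mxE (ord1 i).
have slp := polymap_comp sp lp.
have sp' : vpolymap sigma'.
  apply: embp => //; apply: polymapM => //; apply: polymapM; first exact: polymap_const.
  exact: polymap_comp Kp (polymap_mxvec slp).
have compM q : mpolyfun q -> vpolyfun (fun x => q (sigma x)).
  by move=> qp; apply: polyfun_comp qp (polymap_mxvec sp).
pose h0 x := f x * (delta (sigma x) * D (sigma x)).
have h0p : vpolyfun h0 by apply: polyfunM => //; apply: polyfunM; apply: compM.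
pose f' z := h0 (lsubmx z) * g (sigma' z).
have fp' : vpolyfun f'.
  apply: polyfunM; first exact: polyfun_comp h0p lp.
  exact: polyfun_comp gp (polymap_mxvec sp').
have f'P z : f' z != 0 -> [/\ f (lsubmx z) != 0, delta (sigma (lsubmx z)) != 0,
    D (sigma (lsubmx z)) != 0 & g (sigma' z) != 0].
  by rewrite !mulf_eq0 !negb_or -!andbA => /and4P.
have f'0 : f' (row_mx x0 (w1 *m G)) != 0.
  have w1M : w1 *m M B0 = 0 by apply/LM => //; apply: Xs.
  have := ker_param B0 w1 w1M; rewrite D1 scale1r => w1E.
  rewrite /f' /h0 /sigma' !row_mxKl row_mxKr -/B0 /par -w1E D1 mulr1.
  by rewrite !mulf_neq0.
exists sigma', f', (fun A => eta (ret A) * D (ret A)), (fun A =>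
  row_mx (D (ret A) *: pi (ret A)) (eta (ret A) *: (wco A *m G))).
have retC q : mpolyfun q -> mpolyfun (fun A => q (ret A)).
  by move=> qp; apply: polyfun_comp qp (polymap_mxvec retp).
split; first split => //.
- by apply: polyfunM; apply: retC.
- apply: polymap_row; apply: polymapZ; try exact: retC.
    exact: polymap_comp pip (polymap_mxvec retp).
  by apply: polymapM => //; apply: polymap_const.
split.
- by exists (row_mx x0 (w1 *m G)).
- by move=> z /f'P [fz dz Dz gz]; apply: gE => //; [apply: Xs|apply: parM => //; apply: Xs].
- move=> z /f'P [fz dz Dz gz]; have YB := Xs _ fz.
  have [eta0 piE] := inv _ fz.
  have [-> ->] := embK (par (sigma (lsubmx z)) (rsubmx z)) YB.
  split; first by rewrite mulf_neq0.
  rewrite piE /par -mulmxA WKG mul_mx_scalar !scalerA [D _ * _]mulrC.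
  by rewrite -scale_row_mx hsubmxK.
move=> q qp q0 A EA.
have {}q0 : forall z, q (sigma' z) = 0.
  by apply: (polyfun_cancel fp' _ f'0) => //; apply: polyfun_comp qp (polymap_mxvec sp').
(* [A] may lie over a point where the trivialization at [B0] degenerates. The one at [ret A] extends
   [wco A] to a polynomial family [x] that is a section of [L] nearby; [q] vanishes along it over
   generic points of the chart of [Y], hence over all of [Y] by density. *)
have [YA LA AE] := retE EA.
have [delta' [M' [_ [_ [[dp' Mp' _ dA'] [rM' LM' _ _]]]]]] := local YA.
set Y' := fun B => Y B /\ delta' B != 0.
have rM2 B : Y' B -> \rank (M' B) = c by case; apply: rM'.
have wA : wco A *m M' (ret A) = 0 by apply/LM'.
have [x [delta'' [xp dp'' xA dA'' xM]]] :=
  kernel_section Mp' rM2 (conj YA dA') wA.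
have qxp : mpolyfun (fun B => q (emb B (x B))).
  by apply: polyfun_comp qp _; apply: polymap_mxvec; apply: embp => //; apply: mpolymap_id.
rewrite -AE -xA; apply: (dens _ qxp _ _ YA) => y _; move: y.
have ddp : mpolyfun (fun B => delta' B * delta'' B) by apply: polyfunM.
have [x1 [fx1 ddx1]] := exists_poly_nonzero dens ddp YA (mulf_neq0 dA' dA'').
have h00 : h0 x0 != 0.
  by rewrite /h0 -/B0 D1 mulr1 mulf_neq0.
have [x2 [h02 dd2]] := polyfun_domain h0p (compM _ ddp) h00 ddx1.
apply: (polyfun_cancel (polyfunM h0p (compM _ ddp)) (compM _ qxp) (mulf_neq0 h02 dd2)).
move=> y; rewrite !mulf_eq0 !negb_or => /andP[/and3P[fy dy Dy] /andP[d1y d2y]].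
set B := sigma y in dy Dy d1y d2y *; have YB : Y B := Xs _ fy.
have xB0 : x B *m M B = 0 by apply/LM => //; apply/LM' => //; apply: xM.
have xBE : x B = par B ((D B)^-1 *: (x B *m G)).
  by rewrite /par -scalemxAl -ker_param // scalerA mulVf // scale1r.
by have := q0 (row_mx y ((D B)^-1 *: (x B *m G))); rewrite /sigma' row_mxKl row_mxKr -xBE.
Qed.

End Bundle.

(** * Nilpotent matrices and cyclic extensions *)

Section NilpotentSimilarity.
Variable F : fieldType.

Lemma trmx_expr n (A : 'M[F]_n) k : (A ^+ k)^T = A^T ^+ k.
Proof.
elim: k => [|k IH]; first by rewrite !expr0 trmx1.
by rewrite exprS exprSr -IH -!mulmxE trmx_mul.
Qed.

Lemma intertwine_expr n (P A B : 'M[F]_n) k :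
  P *m A = B *m P -> P *m A ^+ k = B ^+ k *m P.
Proof.
move=> PA; elim: k => [|k IH]; first by rewrite !expr0 mulmx1 mul1mx.
by rewrite !exprSr -!mulmxE mulmxA IH -!mulmxA PA.
Qed.

Lemma exists_row_base m n (A : 'M[F]_(m, n)) :
  exists T : 'M[F]_(\rank A, n), row_free T /\ (T :=: A)%MS.
Proof. by exists (row_base A); split; [apply: row_base_free | apply: eq_row_base]. Qed.

(** [V] is injective on the left kernel of [M], so [Y] can be chosen to send the image of that
    kernel isomorphically onto a complement of the row space of [M], and everything else into this
    complement. *)
Lemma unit_completion k n (M : 'M[F]_k) (V : 'M[F]_(k, n)) :
  (forall y : 'rV_k, y *m M = 0 -> y *m V = 0 -> y = 0) ->
  exists Y, M + V *m Y \in unitmx.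
Proof.
move=> inj; have [T [Tf TE]] := exists_row_base (kermx M).
have TM : T *m M = 0 by apply/eqP; rewrite -sub_kermx TE.
have [W TVW] : exists W, T *m V *m W = 1%:M.
  apply/row_freeP; rewrite -kermx_eq0; apply/rowV0P => y /sub_kermxP yTV.
  apply: (row_free_inj Tf); rewrite mul0mx.
  by apply: inj; rewrite -mulmxA ?TM ?mulmx0.
have [C [Q [CQ Cf Qf]]] : exists (C : 'M_(k, \rank (kermx M))) (Q : 'M_(_, k)),
    [/\ C *m Q = M^C%MS, row_full C & row_free Q].
  by apply: rank_factorization; rewrite mxrank_compl mxrank_ker.
exists (W *m Q); rewrite -row_free_unit -kermx_eq0; apply/rowV0P => y /sub_kermxP.
rewrite mulmxDr !mulmxA => /eqP; rewrite addr_eq0 => /eqP yM.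
have Qc : (Q <= M^C)%MS by rewrite -CQ eqmxMfull.
have yM0 : y *m M = 0.
  apply/eqP; rewrite -submx0 -(capmx_compl M) sub_capmx submxMl /= yM.
  by rewrite eqmx_opp mulmx_sub.
have /submxP[z yz] : (y <= T)%MS by rewrite TE sub_kermx yM0.
have zQ : z *m Q = 0.
  apply/eqP; rewrite -oppr_eq0 -[z]mulmx1 -TVW !mulmxA -yz -yM yM0 eqxx //.
rewrite yz; suff -> : z = 0 by rewrite mul0mx.
by apply: (row_free_inj Qf); rewrite mul0mx.
Qed.

(** With [K] a basis of the left kernel of [D], any 1 + X K fixes [D]. Writing R - S = H K, the
    condition on [S] becomes S X = H, whose solutions are Sr H + (1 - Sr S) Y; invertibility of 1 +
    X K follows from that of 1 + K X, for which [unit_completion] provides [Y]. *)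
Lemma fixing_completion r n (D : 'M[F]_(n, r)) (R S : 'M[F]_(r, n)) :
  row_free R -> R *m D = S *m D -> row_free S ->
  exists2 P, P \in unitmx & P *m D = D /\ S *m P = R.
Proof.
move=> Rf RD Sf; have [Sr SSr] := row_freeP Sf.
have [K [Kf KE]] := exists_row_base (kermx D).
have KD : K *m D = 0 by apply/eqP; rewrite -sub_kermx KE.
have [H RSH] : exists H, R - S = H *m K.
  by apply/submxP; rewrite KE sub_kermx mulmxBl RD subrr.
have [Y MY] : exists Y, (1%:M + K *m Sr *m H) + (K *m (1%:M - Sr *m S)) *m Y \in unitmx.
  apply: unit_completion => y; rewrite mulmxDr mulmx1 !mulmxA => /eqP.
  rewrite addr_eq0 => /eqP yE; rewrite mulmxBr mulmx1 => /eqP.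
  rewrite subr_eq0 !mulmxA => /eqP yK.
  have aR : y *m K *m Sr *m R = 0.
    rewrite -[R](subrK S) mulmxDr RSH mulmxA -yK.
    by have := congr1 -%R yE; rewrite opprK => <-; rewrite mulNmx addNr.
  have a0 : y *m K *m Sr = 0 by apply: (row_free_inj Rf); rewrite mul0mx.
  by rewrite yE a0 mul0mx oppr0.
set X := Sr *m H + (1%:M - Sr *m S) *m Y.
have KX : 1%:M + K *m X \in unitmx by move: MY; rewrite /X mulmxDr !mulmxA addrA.
exists (1%:M + X *m K).
  rewrite -row_free_unit -kermx_eq0; apply/rowV0P => x /sub_kermxP.
  rewrite mulmxDr mulmx1 mulmxA => /eqP; rewrite addr_eq0 => /eqP xE.
  suff z0 : x *m X = 0 by rewrite xE z0 mul0mx oppr0.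
  apply: (row_free_inj (A := 1%:M + K *m X)); first by rewrite row_free_unit.
  by rewrite mul0mx mulmxDr mulmx1 mulmxA {1}xE mulNmx -mulmxA addNr.
split; first by rewrite mulmxDl mul1mx -mulmxA KD mulmx0 addr0.
rewrite mulmxDr mulmx1 /X mulmxDl mulmxDr !mulmxA SSr mul1mx mulmxBr mulmx1 !mulmxA.
by rewrite SSr mul1mx subrr !mul0mx addr0 -RSH addrC subrK.
Qed.

(** This is the lifting step for [nilpotent_similar]: P C R = D R = D S P, so [P] intertwines C R
    and D S. *)
Lemma factor_completion r n (C D : 'M[F]_(n, r)) (R S : 'M[F]_(r, n)) :
  row_full C -> row_full D -> row_free R -> row_free S -> R *m C = S *m D ->
  exists2 P, P \in unitmx & P *m C = D /\ S *m P = R.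
Proof.
move=> Cf Df Rf Sf RC.
have [P0 P0u P0C] : exists2 P, P \in unitmx & P *m C = D.
  have Cf' : row_free C^T by rewrite /row_free mxrank_tr.
  have [|g gu] := complete_unitmx (U := C^T) (f := pinvmx C^T *m D^T).
    by rewrite mulmxA mulmxVp // mul1mx !mxrank_tr (eqP Cf) (eqP Df).
  rewrite mulmxA mulmxVp // mul1mx => /(congr1 trmx); rewrite trmxK trmx_mul trmxK => DE.
  by exists g^T; rewrite ?unitmx_tr.
have [||P1 P1u [P1D SP1]] := @fixing_completion _ _ D (R *m invmx P0) S _ _ Sf.
- by rewrite /row_free mxrankMfree // row_free_unit unitmx_inv.
- by rewrite -P0C mulmxA mulmxKV // RC P0C.
exists (P1 *m P0); first by rewrite unitmx_mul P1u.
by rewrite -mulmxA P0C P1D mulmxA SP1 mulmxKV.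
Qed.

Lemma expr_factor r n (C : 'M[F]_(n, r)) (R : 'M[F]_(r, n)) k :
  (C *m R) ^+ k.+1 = C *m (R *m C) ^+ k *m R.
Proof.
elim: k => [|k IH]; first by rewrite expr1 expr0 mulmx1.
by rewrite exprS IH [in RHS]exprS -!mulmxE !mulmxA.
Qed.

Lemma rank_expr_factor r n (C : 'M[F]_(n, r)) (R : 'M[F]_(r, n)) k :
  row_full C -> row_free R -> \rank ((C *m R) ^+ k.+1) = \rank ((R *m C) ^+ k).
Proof. by move=> Cf Rf; rewrite expr_factor mxrankMfree // eqmxMfull. Qed.

(* Induction on n: A = C R and R C have the same invariants up to a shift, and R C
   has size \rank A; an intertwiner of R C lifts to one of C R. *)
Theorem nilpotent_similar n (A B : 'M[F]_n) k0 :
  A ^+ k0 = 0 -> (forall k, \rank (A ^+ k) = \rank (B ^+ k)) ->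
  exists2 P, P \in unitmx & P *m A = B *m P.
Proof.
have [m] := ubnP n; elim: m n A B k0 => // m IH n A B k0 nm A0 rAB.
have rA := rAB 1%N; rewrite !expr1 in rA.
have [rn|rn] := ltnP (\rank A) n; last first.
  have Au : A \in unitmx by rewrite -row_free_unit -row_leq_rank.
  have Ak : forall k, A ^+ k \in unitmx.
    by elim=> [|k Ak]; rewrite ?expr0 ?unitmx1 // exprS -mulmxE unitmx_mul Au.
  have n0 : n = 0%N by rewrite -(mxrank_unit (Ak k0)) A0 mxrank0.
  by exists 1%:M; rewrite ?unitmx1 //; subst n; rewrite !flatmx0.
have [C [R [AE Cf Rf]]] := rank_factorization (erefl (\rank A)).
have [D [S [BE Df Sf]]] := rank_factorization (esym rA).
have [|||Q Qu QRC] := IH _ (R *m C) (S *m D) k0.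
- exact: leq_trans rn _.
- apply/eqP; rewrite -mxrank_eq0 -(rank_expr_factor _ Cf Rf) AE exprS A0 mulr0.
  by rewrite mxrank0.
- by move=> k; rewrite -(rank_expr_factor _ Cf Rf) -(rank_expr_factor _ Df Sf) AE BE.
(* [Q] moves the factorization D S of [B] to (D Q)(Q^-1 S), whose product in the other order equals
   R C. *)
have [|||P Pu [PC SP]] := @factor_completion _ _ C (D *m Q) R (invmx Q *m S) Cf _ Rf.
- by rewrite /row_full mxrankMfree // row_free_unit.
- by rewrite /row_free eqmxMfull // row_full_unit unitmx_inv.
- by rewrite -[RHS]mulmxA [S *m _]mulmxA -QRC mulKmx.
exists P => //; rewrite -AE mulmxA PC -BE -SP !mulmxA.
by rewrite mulmxK.
Qed.

End NilpotentSimilarity.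

(** * Ranks of the powers of a cyclic extension *)

Section CyclicExtension.
Variable F : fieldType.

Lemma rank_partial_perm n (P : pred 'I_n) (h : 'I_n -> 'I_n) :
  {in P &, injective h} ->
  \rank (\matrix_(i, j) (P i && (j == h i))%:R : 'M[F]_n) = #|P|.
Proof.
move=> hinj; set M := \matrix_(i, j) _.
pose S : 'M[F]_(#|P|, n) := \matrix_(k, j) (j == enum_val k)%:R.
have SE m (X : 'M_(n, m)) k j : (S *m X) k j = X (enum_val k) j.
  rewrite mxE (bigD1 (enum_val k)) //= mxE eqxx mul1r big1 ?addr0 // => i.
  by rewrite mxE => /negPf ->; rewrite mul0r.
apply/eqP; rewrite eqn_leq; apply/andP; split.
  have -> : M = S^T *m (S *m M).
    apply/matrixP => i j; rewrite [RHS]mxE; case Pi: (P i); last first.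
      rewrite mxE Pi big1 // => k _; rewrite SE !mxE; case: eqP => [ik|]; last by rewrite mul0r.
      by move: (enum_valP k); rewrite -ik -topredE /= Pi.
    have [k0 k0E] : exists k0 : 'I_#|P|, enum_val k0 = i.
      by exists (enum_rank_in (Pi : i \in P) i); rewrite enum_rankK_in.
    rewrite (bigD1 k0) //= SE !mxE k0E eqxx mul1r big1 ?addr0 // => k /negPf ki.
    rewrite !mxE; case: eqP => [ik|]; last by rewrite mul0r.
    by move: ki; rewrite -(inj_eq enum_val_inj) -ik k0E eqxx.
  exact: leq_trans (mxrankM_maxl _ _) (rank_leq_col _).
have XE k j : (S *m M) k j = (j == h (enum_val k))%:R.
  by rewrite SE mxE; have := enum_valP k; rewrite -topredE /= => ->.
have SMS : (S *m M) *m (S *m M)^T = 1%:M.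
  apply/matrixP => k l; rewrite [RHS]mxE [LHS]mxE (bigD1 (h (enum_val k))) //=.
  rewrite [(S *m M)^T _ _]mxE !XE eqxx mul1r.
  rewrite big1 ?addr0 => [|j /negPf jk]; last by rewrite XE jk mul0r.
  congr (_%:R); congr (nat_of_bool _); apply/eqP/eqP => [/hinj|-> //].
  by move=> /(_ (enum_valP _) (enum_valP _)) /enum_val_inj.
rewrite -{1}(mxrank1 F #|P|) -SMS.
by apply: leq_trans (mxrankM_maxl _ _) _; apply: mxrankM_maxr.
Qed.

(** The transpose of one Jordan block: on row vectors it lowers the index by one, so the last basis
    vector generates. *)
Definition shift_mx p : 'M[F]_p := \matrix_(b, c) (b == c.+1 :> nat)%:R.

Lemma shift_mxX p k : shift_mx p ^+ k = \matrix_(b, c) (b == (c + k)%N :> nat)%:R.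
Proof.
elim: k => [|k IH].
  by apply/matrixP => b c; rewrite expr0 !mxE addn0.
apply/matrixP => b c; rewrite exprSr IH -mulmxE !mxE.
have [cp|cp] := ltnP c.+1 p; last first.
  rewrite [in RHS](_ : _ == _ = false); last first.
    apply/negP => /eqP bc; move: (ltn_ord b); rewrite bc addnS ltnNge.
    by rewrite (leq_trans cp) // ltnS leq_addr.
  rewrite big1 // => d _; rewrite !mxE; case: (_ =P c.+1) => [dc|_]; last exact: mulr0.
  by move: (ltn_ord d); rewrite dc ltnNge cp.
rewrite (bigD1 (Ordinal cp)) //= !mxE eqxx mulr1 addSnnS big1 ?addr0 // => d.
rewrite -val_eqE !mxE /= => /negPf ->; exact: mulr0.
Qed.

Lemma rank_shift_mxX p k : \rank (shift_mx p ^+ k) = (p - k)%N.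
Proof.
have lt_pred (b : 'I_p) : (b - k < p)%N by apply: leq_ltn_trans (leq_subr _ _) _.
have -> : shift_mx p ^+ k = \matrix_(b, c) ((k <= b)%N && (c == Ordinal (lt_pred b)))%:R.
  rewrite shift_mxX; apply/matrixP => b c; rewrite !mxE -val_eqE /=; congr (_%:R).
  by congr nat_of_bool; apply/idP/idP; lia.
rewrite (@rank_partial_perm p (fun b => k <= b)%N (fun b => Ordinal (lt_pred b))).
  rewrite -sum1_card -(big_mkord (fun b => k <= b)%N (fun=> 1%N)).
  case: (leqP k p) => kp; last first.
    by rewrite big_nat_cond big1 => [|b]; lia.
  rewrite (big_cat_nat _ kp) //= big_nat_cond big1 ?add0n => [|b]; last by lia.
  rewrite big_nat_cond (eq_bigl (fun b => k <= b < p)%N) => [|b]; last by lia.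
  by rewrite -big_nat sum_nat_const_nat muln1.
move=> b c kb kc /(congr1 val) /= bc; apply: val_inj => /=.
by move: kb kc bc; rewrite -!topredE /=; lia.
Qed.

End CyclicExtension.

Section ExtensionRank.
Variables (F : fieldType) (n p : nat) (N : 'M[F]_n) (C : 'M[F]_(p, n)).

Lemma shift_mx_rows (r : nat -> 'rV[F]_n) :
  shift_mx F p *m (\matrix_(b < p) r b) =
  \matrix_(b < p) (if (b : nat) is b'.+1 then r b' else 0).
Proof.
apply/matrixP => b j; rewrite !mxE; case: b => [[|b] /= bp].
  by rewrite mxE big1 // => c _; rewrite !mxE mul0r.
rewrite (bigD1 (Ordinal (ltnW bp))) //= !mxE /= eqxx mul1r big1 ?addr0 // => c.
by rewrite -val_eqE !mxE /= eqSS eq_sym => /negPf ->; rewrite mul0r.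
Qed.

(* The module with matrix block_mx N 0 C (shift_mx p), acting on row vectors, is an
   extension of a cyclic one, generated by the last basis vector, by that of N;
   this is the image of the generator under the p-th power. *)
Definition ext_class : 'rV[F]_n := \sum_(b < p) row b C *m N ^+ b.

(** For [k = 1] only row 0 can be nonzero, and it equals [u]: the normal form of an extension of
    class [u]. Larger [k] gives the corresponding block of its k-th power. *)
Definition ext_rows (u : 'rV[F]_n) k : 'M[F]_(p, n) :=
  \matrix_(b < p) (if (b < k)%N then u *m N ^+ (k.-1 - b) else 0).

Lemma ext_conj : exists2 X, X \in unitmx &
  X *m block_mx N 0 C (shift_mx F p) = block_mx N 0 (ext_rows ext_class 1) (shift_mx F p) *m X.
Proof.
(* These Horner tails of [ext_class] satisfy x b = row b C + x (b + 1) N, so adding x (b + 1) to the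
   b-th basis vector of the quotient sweeps [C] into row 0. *)
pose x (b : nat) := \sum_(j < p | (b <= j)%N) row j C *m N ^+ (j - b).
have xS (b : 'I_p) : x b = row b C + x b.+1 *m N.
  rewrite /x (bigD1 b) //= subnn expr0 mulmx1; congr (_ + _); rewrite mulmx_suml.
  apply: eq_big => j; first by rewrite -val_eqE /=; lia.
  move=> /andP[bj jb]; rewrite -mulmxA mulmxE -exprSr; congr (_ *m _ ^+ _).
  by move: jb; rewrite -val_eqE /=; lia.
have x0 : x 0%N = ext_class.
  by apply: eq_big => // j _; rewrite subn0.
exists (block_mx 1%:M 0 (\matrix_(b < p) x b.+1) 1%:M).
  by rewrite unitmxE det_lblock !det1 mulr1 unitr1.
rewrite !mulmx_block !mul1mx !mulmx1 !mul0mx !mulmx0 !addr0 !add0r.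
congr (block_mx _ _ _ _); apply/row_matrixP => b.
rewrite (shift_mx_rows (fun b => x b.+1)) !linearD /= row_mul !rowK addrC -xS.
case: b => [[|b] bp] /=; first by rewrite expr0 mulmx1 addr0 x0.
by rewrite add0r.
Qed.

Lemma ext_expr (u : 'rV[F]_n) k :
  block_mx N 0 (ext_rows u 1) (shift_mx F p) ^+ k =
  block_mx (N ^+ k) 0 (ext_rows u k) (shift_mx F p ^+ k).
Proof.
elim: k => [|k IH].
  rewrite !expr0; transitivity (1%:M : 'M[F]_(n + p)) => //.
  rewrite (scalar_mx_block n p 1); congr (block_mx _ _ _ _).
  by apply/row_matrixP => b; rewrite rowK row0.
rewrite !exprS IH -mulmxE mulmx_block !mul0mx !mulmx0 !addr0 !add0r.
congr (block_mx _ _ _ _); apply/row_matrixP => b.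
rewrite (shift_mx_rows (fun b => if (b < k)%N then u *m N ^+ (k.-1 - b) else 0)).
rewrite linearD /= row_mul !rowK; case: b => [[|b] bp] /=.
  by rewrite expr0 mulmx1 addr0 subn0.
rewrite mul0mx add0r ltnS; case: ltnP => // bk; congr (_ *m _ ^+ _); lia.
Qed.

(** [ext_rows u k] is supported on the rows b < k and the k-th power of the shift on the rows b >=
    k, so splitting these rows by the projector [e] separates the two contributions. *)
Lemma rank_ext_expr (u : 'rV[F]_n) k :
  \rank (block_mx N 0 (ext_rows u 1) (shift_mx F p) ^+ k) =
  (\rank (col_mx (N ^+ k) (ext_rows u k)) + (p - k))%N.
Proof.
rewrite ext_expr -(rank_shift_mxX F p k) -rank_diag_block_mx.
set Z := ext_rows u k; set S := shift_mx F p ^+ k.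
pose e : 'M[F]_p := \matrix_(b, c) ((b == c) && (b < k)%N)%:R.
have eE m (X : 'M[F]_(p, m)) b j : (e *m X) b j = if (b < k)%N then X b j else 0.
  rewrite mxE (bigD1 b) //= mxE eqxx big1 ?addr0 => [|c /negPf bc].
    by case: ifP; rewrite ?mul1r ?mul0r.
  by rewrite mxE eq_sym bc mul0r.
have eZ : e *m Z = Z by apply/matrixP => b j; rewrite eE; case: ifP => // bk; rewrite mxE bk mxE.
have eS : e *m S = 0.
  apply/matrixP => b j; rewrite eE /S shift_mxX !mxE; case: ifP => // bk.
  by rewrite (_ : _ == _ = false) //; apply/eqP; lia.
apply: eqmx_rank; apply/andP; split; apply/submxP.
  exists (block_mx (row_mx 1%:M 0) 0 (row_mx 0 1%:M) 1%:M).
  rewrite mulmx_block !mul_row_col !mul1mx !mul0mx !mulmx0 !addr0 !add0r.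
  by [].
exists (block_mx (col_mx 1%:M 0) (col_mx 0 e) 0 (1%:M - e)).
rewrite mulmx_block !mul_col_mx !mul1mx !mul0mx eZ eS !mulmxBl !mul1mx eZ eS.
by rewrite !add_col_mx !addr0 !add0r subrr subr0 col_mx0.
Qed.

Lemma rank_ext_rows (u : 'rV[F]_n) k : exists o,
  [/\ (k - p <= o)%N, (u *m N ^+ o <= N ^+ k)%MS,
      forall j, (k - p <= j < o)%N -> ~~ (u *m N ^+ j <= N ^+ k)%MS
    & (\rank (col_mx (N ^+ k) (ext_rows u k)) + (k - p) = \rank (N ^+ k) + o)%N].
Proof.
have uk : (u *m N ^+ k <= N ^+ k)%MS by apply: submxMl.
have ex : exists o, (k - p <= o)%N && (u *m N ^+ o <= N ^+ k)%MS.
  by exists k; rewrite uk leq_subr.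
case: (ex_minnP ex) => o /andP[kpo uo] omin; exists o.
have ok : (o <= k)%N by apply: omin; rewrite uk leq_subr.
have nu j : (k - p <= j < o)%N -> ~~ (u *m N ^+ j <= N ^+ k)%MS.
  by move=> /andP[kj jo]; apply/negP => uj; have := omin j; rewrite kj uj leqNgt jo => /(_ isT).
have above i : (o <= i)%N -> (u *m N ^+ i <= N ^+ k)%MS.
  move=> oi; rewrite -(subnK oi) addnC exprD -mulmxE mulmxA.
  apply: submx_trans (submxMr _ uo) _; rewrite mulmxE -exprD addnC exprD.
  exact: submxMl.
split=> //.
(* The rows involve exactly the exponents from k - p to k - 1. Those from [o] on add nothing to the
   image of N^k, and going down from [o] each one adds exactly one dimension. *)
pose W j := (N ^+ k + \sum_(j <= i < k) <<u *m N ^+ i>>)%MS.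
have Wrow i j : (j <= i < k)%N -> (u *m N ^+ i <= W j)%MS.
  move=> ijk; apply: submx_trans (addsmxSr _ _).
  rewrite (big_rem i) ?mem_index_iota //=; apply: submx_trans (addsmxSl _ _).
  by rewrite genmxE.
have Wsub m j (X : 'M_(m, n)) : (N ^+ k <= X)%MS ->
    (forall i, (j <= i < k)%N -> (u *m N ^+ i <= X)%MS) -> (W j <= X)%MS.
  move=> kX iX; rewrite addsmx_sub kX big_nat /=; elim/big_ind: _ => [|A B AX BX|i ijk].
  - exact: sub0mx.
  - by rewrite addsmx_sub AX BX.
  - by rewrite genmxE iX.
have -> : \rank (col_mx (N ^+ k) (ext_rows u k)) = \rank (W (k - p)%N).
  apply: eqmx_rank; apply/andP; split; last first.
    apply: Wsub; first by rewrite -addsmxE addsmxSl.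
    move=> i ik; have bp : (k.-1 - i < p)%N by lia.
    rewrite -addsmxE; apply: submx_trans (addsmxSr _ _).
    apply: (eq_row_sub (Ordinal bp)); rewrite rowK /= ifT; last by lia.
    by congr (_ *m _ ^+ _); lia.
  rewrite col_mx_sub addsmxSl; apply/row_subP => b; rewrite rowK.
  case: ifP => bk; last exact: sub0mx.
  by apply: Wrow; have := ltn_ord b; lia.
suff rW d : (d <= o - (k - p))%N -> \rank (W (o - d)%N) = (\rank (N ^+ k) + d)%N.
  have := rW (o - (k - p))%N (leqnn _); rewrite subKn // => ->.
  by rewrite -addnA subnK.
elim: d => [_|d IH dle].
  rewrite subn0 addn0; apply: eqmx_rank; rewrite addsmxSl andbT.
  by apply: Wsub => // i /andP[oi _]; apply: above.
have {}IH := IH (ltnW dle).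
set j := (o - d.+1)%N; have jd : (o - d)%N = j.+1 by lia.
rewrite jd in IH.
have jk : (k - p <= j < o)%N by lia.
have jW : ~~ (u *m N ^+ j <= W j.+1)%MS.
  (* This factor raises the exponent [j] to o - 1 and all larger ones to at least [o], which would
     put u N^(o-1) into the image of N^k against the minimality of [o]. *)
  apply/negP => /(submxMr (N ^+ (o.-1 - j))); rewrite -mulmxA mulmxE -exprD.
  rewrite subnKC; last by lia.
  move=> uo1; suff : (u *m N ^+ o.-1 <= N ^+ k)%MS by apply/negP/nu; lia.
  apply: submx_trans uo1 _.
  have WM m (X : 'M_(m, n)) (Z : 'M_n) : (N ^+ k *m Z <= X)%MS ->
      (forall i, (j.+1 <= i < k)%N -> (u *m N ^+ i *m Z <= X)%MS) ->
      (W j.+1 *m Z <= X)%MS.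
    move=> kX iX; rewrite addsmxMr addsmx_sub kX big_nat /=.
    elim/big_ind: _ => [|A B AX BX|i ijk]; first by rewrite mul0mx sub0mx.
      by rewrite addsmxMr addsmx_sub AX BX.
    by rewrite (eqmxMr Z (genmxE _)) iX.
  apply: WM => [|i /andP[ji _]].
    by rewrite mulmxE -exprD addnC exprD; apply: submxMl.
  by rewrite -mulmxA mulmxE -exprD; apply: above; lia.
have jWE : (W j :=: W j.+1 + u *m N ^+ j)%MS.
  apply/eqmxP/andP; split.
    apply: Wsub => [|i /andP[ji ik]].
      by apply: submx_trans (addsmxSl _ _); apply: addsmxSl.
    have [->|ij] := eqVneq i j; first exact: addsmxSr.
    by apply: submx_trans (addsmxSl _ _); apply: Wrow; lia.
  rewrite addsmx_sub Wrow ?andbT; last by lia.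
  by apply: Wsub => [|i ik]; [apply: addsmxSl | apply: Wrow; lia].
rewrite jWE; apply/eqP; rewrite eqn_leq; apply/andP; split.
  have [le1 _] := mxrank_adds_leqif (W j.+1) (u *m N ^+ j).
  apply: leq_trans le1 _; rewrite IH -addnA leq_add2l -[d.+1]addn1 leq_add2l.
  exact: rank_leq_row.
rewrite addnS -IH; apply: rank_ltmx.
by rewrite ltmxE addsmxSl /= addsmx_sub negb_and jW orbT.
Qed.

Lemma rank_ext k : exists o,
  [/\ (k - p <= o)%N, (ext_class *m N ^+ o <= N ^+ k)%MS,
      forall j, (k - p <= j < o)%N -> ~~ (ext_class *m N ^+ j <= N ^+ k)%MS
    & (\rank (block_mx N 0 C (shift_mx F p) ^+ k) + k = \rank (N ^+ k) + p + o)%N].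
Proof.
have [o [kpo uo nu rE]] := rank_ext_rows ext_class k; exists o; split=> //.
have [X Xu XE] := ext_conj.
have -> : \rank (block_mx N 0 C (shift_mx F p) ^+ k) =
          \rank (block_mx N 0 (ext_rows ext_class 1) (shift_mx F p) ^+ k).
  set A := block_mx N 0 C _ in XE *; set B := block_mx N 0 _ _ in XE *.
  rewrite -[RHS](mxrankMfree _ (B := X)) ?row_free_unit // -(intertwine_expr _ XE).
  by rewrite eqmxMfull ?row_full_unit.
by rewrite rank_ext_expr; lia.
Qed.

End ExtensionRank.

Lemma sum_reshape (sh : seq nat) (f : nat -> nat -> nat) :
  (\sum_(i < sumn sh) f (reshape_index sh i) (reshape_offset sh i) =
   \sum_(r < size sh) \sum_(c < nth 0%N sh r) f r c)%N.
Proof.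
elim: sh f => [|s sh IH] f; first by rewrite !big_ord0.
rewrite /= big_split_ord big_ord_recl /=; congr (_ + _)%N.
  apply: eq_bigr => i _ /=.
  have lt : (i < nth 0%N (s :: sh) 0)%N by [].
  have := flatten_indexKl lt; have := flatten_indexKr lt.
  by rewrite /flatten_index /= => -> ->.
rewrite -(IH (fun r => f r.+1)); apply: eq_bigr => i _ /=.
have lt : (reshape_offset sh i < nth 0%N (s :: sh) (reshape_index sh i).+1)%N.
  exact: reshape_offsetP.
have := flatten_indexKl lt; have := flatten_indexKr lt.
have -> : flatten_index (s :: sh) (reshape_index sh i).+1 (reshape_offset sh i) = (s + i)%N.
  by rewrite /flatten_index /= -addnA [X in (_ + X)%N](reshape_indexK sh i).
by move=> -> ->.
Qed.

(** * Jordan coordinates *)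

Section JordanCoordinates.
Variables (F : fieldType) (n : nat) (sh : seq nat).
Hypothesis sh_n : sumn sh = n.
Local Notation idx := (reshape_index sh).
Local Notation off := (reshape_offset sh).
Local Notation J := (jordan_mx F n sh).

Lemma ord_sumn (i : 'I_n) : (i < sumn sh)%N.
Proof. by rewrite sh_n. Qed.

Lemma off_lt (i : 'I_n) : (off i < nth 0%N sh (idx i))%N.
Proof. exact: reshape_offsetP (ord_sumn i). Qed.

Lemma idx_off_inj (i j : 'I_n) : idx i = idx j -> off i = off j -> i = j.
Proof.
move=> ij oij; apply: val_inj => /=.
by rewrite -(reshape_indexK sh i) -(reshape_indexK sh j) ij oij.
Qed.

Lemma idx_off_ex r c : (c < nth 0%N sh r)%N -> exists i : 'I_n, idx i = r /\ off i = c.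
Proof.
move=> cr; have := flatten_indexP cr; rewrite sh_n => lt.
by exists (Ordinal lt) => /=; rewrite flatten_indexKl // flatten_indexKr.
Qed.

Lemma jordan_mxX k : J ^+ k =
  \matrix_(i, j) ((idx i == idx j) && (off i + k == off j)%N)%:R.
Proof.
elim: k => [|k IH].
  rewrite expr0; apply/matrixP => i j; rewrite !mxE addn0; congr (_%:R).
  congr nat_of_bool; apply/eqP/andP => [->|[/eqP ij /eqP oij]]; first by rewrite !eqxx.
  exact: idx_off_inj.
rewrite exprSr IH -mulmxE; apply/matrixP => i j; rewrite !mxE.
case: (boolP ((idx i == idx j) && (off i + k.+1 == off j)%N)) => [/andP[/eqP ij /eqP oij]|nij].
  have [|l [li lo]] := @idx_off_ex (idx j) (off i + k)%N.
    by apply: ltn_trans (off_lt j); rewrite -oij addnS.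
  rewrite (bigD1 l) //= !mxE ij li lo -addnS oij !eqxx mul1r big1 ?addr0 // => x xl.
  rewrite !mxE; case: eqP => [ix|_]; last by rewrite mul0r.
  case: eqP => [ox|_]; last by rewrite mul0r.
  by case/eqP: xl; apply: idx_off_inj; rewrite ?li ?lo -?ij ?ix ?ox.
rewrite big1 // => x _; rewrite !mxE; case: eqP => [ix|_]; last by rewrite mul0r.
case: (_ =P off x) => [ox|_]; last by rewrite mul0r.
by rewrite mul1r -ix -ox -addnS (negPf nij).
Qed.

Lemma rank_jordan_mxX k :
  \rank (J ^+ k) = (\sum_(0 <= r < size sh) (nth 0%N sh r - k))%N.
Proof.
pose P := [pred i : 'I_n | (off i + k < nth 0%N sh (idx i))%N].
have /fin_all_exists [h hP] : forall i : 'I_n, exists j : 'I_n,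
    P i -> idx j = idx i /\ off j = (off i + k)%N.
  move=> i; case: (boolP (P i)) => [Pi|_]; last by exists i.
  by have [j] := idx_off_ex Pi; exists j.
have -> : J ^+ k = \matrix_(i, j) (P i && (j == h i))%:R.
  rewrite jordan_mxX; apply/matrixP => i j; rewrite !mxE; congr (_%:R); congr nat_of_bool.
  apply/andP/andP => [[/eqP ij /eqP oij]|[Pi /eqP ->]].
    have Pi : P i by rewrite /P /= oij ij off_lt.
    by split=> //; have [hi ho] := hP i Pi; apply/eqP/idx_off_inj; rewrite ?hi ?ho.
  by have [-> ->] := hP i Pi; rewrite !eqxx.
rewrite rank_partial_perm; last first.
  move=> i j Pi Pj hij; have [hi ho] := hP i Pi; have [hi' ho'] := hP j Pj.
  by apply: idx_off_inj; [rewrite -hi hij hi' | apply/eqP; rewrite -(eqn_add2r k) -ho hij ho'].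
rewrite -sum1_card big_mkcond /=.
have := sum_reshape sh (fun r c => if (c + k < nth 0%N sh r)%N then 1%N else 0%N).
rewrite -big_mkcond sh_n /= big_mkcond /= => ->.
rewrite big_mkord; apply: eq_bigr => r _.
have [|] := leqP (nth 0%N sh r) k => kr.
  rewrite big1 => [|c _]; first by lia.
  by case: ifP => //; lia.
rewrite -(big_mkord xpredT (fun c => if (c + k < nth 0%N sh r)%N then 1%N else 0%N)).
rewrite (big_cat_nat (n := nth 0%N sh r - k)%N) ?leq_subr //=.
rewrite big_nat (eq_bigr (fun=> 1%N)) => [|c ck]; last by rewrite ifT //; lia.
rewrite -big_nat sum_nat_const_nat muln1 subn0 big_nat big1 ?addn0 // => c ck.
by rewrite ifF //; lia.
Qed.

Lemma jordan_tr_zero (z : 'rV[F]_n) j (i : 'I_n) :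
  (nth 0%N sh (idx i) <= off i + j)%N -> (z *m J^T ^+ j) 0 i = 0.
Proof.
move=> le; rewrite -trmx_expr mxE big1 // => x _; rewrite !mxE jordan_mxX mxE.
case: andP => [[/eqP ix /eqP ox]|_]; last by rewrite mulr0.
by have := off_lt x; rewrite -ix -ox ltnNge le.
Qed.

(** Since [J^T] lowers offsets, the coordinate of offset c in a block of length a is the coefficient
    of t^(a-1-c). The coordinates that must vanish are the coefficients that survive t^j but land in
    degree less than k. *)
Lemma jordan_tr_sub (z : 'rV[F]_n) j k :
  (z *m J^T ^+ j <= J^T ^+ k)%MS <->
  (forall i : 'I_n, (j <= off i)%N -> (nth 0%N sh (idx i) + j <= off i + k)%N -> z 0 i = 0).
Proof.
rewrite -!trmx_expr; set y := z *m _.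
have yE (i i' : 'I_n) : idx i = idx i' -> (off i + j)%N = off i' -> y 0 i = z 0 i'.
  move=> ii oo; rewrite mxE (bigD1 i') //= !mxE jordan_mxX mxE ii oo !eqxx mulr1.
  rewrite big1 ?addr0 // => x xi; rewrite !mxE.
  case: andP => [[/eqP ix /eqP ox]|_]; last by rewrite mulr0.
  by case/eqP: xi; apply: idx_off_inj; rewrite -?ix -?ox.
have y0 (i : 'I_n) : (nth 0%N sh (idx i) <= off i + j)%N -> y 0 i = 0.
  by rewrite /y trmx_expr; apply: jordan_tr_zero.
split=> [/submxP[x xE] i ji le|z0].
  have [|i' [ii oo]] := @idx_off_ex (idx i) (off i - j)%N.
    by apply: leq_ltn_trans (leq_subr _ _) (off_lt i).
  rewrite -(yE i') ?oo ?subnK // xE mxE big1 // => l _; rewrite !mxE jordan_mxX mxE.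
  case: andP => [[/eqP il /eqP ol]|_]; last by rewrite mulr0.
  by have := off_lt l; rewrite -il -ol ii oo; lia.
(* [J ^+ k] followed by its transpose is the projector onto the coordinates whose offset plus [k] is
   below the block length, and [y] is supported there. *)
apply/submxP; exists (y *m J ^+ k); rewrite -mulmxA; apply/rowP => i.
have yz : (nth 0%N sh (idx i) <= off i + k)%N -> y 0 i = 0.
  move=> le; have [lj|] := leqP (nth 0%N sh (idx i)) (off i + j); first exact: y0.
  move=> /idx_off_ex [i' [ii oo]]; rewrite (yE i i') //; apply: z0; rewrite ?ii ?oo; lia.
rewrite [RHS]mxE (bigD1 i) //= [X in _ = _ + X]big1 ?addr0 => [|i' i'i].
  have [le|lt] := leqP (nth 0%N sh (idx i)) (off i + k); first by rewrite yz // mul0r.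
  have [l [il ol]] := idx_off_ex lt.
  have -> : (J ^+ k *m (J ^+ k)^T) i i = 1; last by rewrite mulr1.
  rewrite mxE (bigD1 l) //= !mxE jordan_mxX !mxE il ol !eqxx mulr1 big1 ?addr0 // => x xl.
  rewrite !mxE; case: andP => [[/eqP ix /eqP ox]|_]; last by rewrite mul0r.
  by case/eqP: xl; apply: idx_off_inj; rewrite ?il ?ol ?ix ?ox.
have -> : (J ^+ k *m (J ^+ k)^T) i' i = 0; last by rewrite mulr0.
rewrite mxE big1 // => l _; rewrite jordan_mxX !mxE.
case: andP => [[/eqP il /eqP ol]|_]; last by rewrite mul0r.
case: andP => [[/eqP il' /eqP ol']|_]; last by rewrite mulr0.
case/eqP: i'i; apply: idx_off_inj; first by rewrite il il'.
by apply/eqP; rewrite -(eqn_add2r k) ol ol'.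
Qed.

End JordanCoordinates.

(** * Horizontal strips *)

Section Interlacing.
Variables (a l : nat -> nat) (m : nat).
Hypothesis a0 : forall j, (m <= j)%N -> a j = 0%N.
Hypothesis l0 : forall j, (m <= j)%N -> l j = 0%N.
Hypothesis al : forall j, (a j <= l j)%N.
Hypothesis la : forall j, (l j.+1 <= a j)%N.

(** Interlacing makes l / a a horizontal strip, whose boxes in the rows from [r] on are counted
    here; the exponent b_r of the overview is [strip_tail r.+1]. *)
Definition strip_tail r := (\sum_(r <= j < m) (l j - a j))%N.

Lemma sum_tailS (f : nat -> nat) r : (forall j, (m <= j)%N -> f j = 0%N) ->
  (\sum_(r <= j < m) f j = f r + \sum_(r.+1 <= j < m) f j)%N.
Proof.
move=> f0; have [rm|mr] := ltnP r m; first by rewrite big_ltn.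
by rewrite !big_geq ?f0 // ltnW.
Qed.

Lemma strip_tailS r : strip_tail r = (l r - a r + strip_tail r.+1)%N.
Proof. by apply: sum_tailS => j mj; rewrite l0. Qed.

(** Interlacing gives l_j - a_j <= l_j - l_(j+1), and the sum telescopes. *)
Lemma strip_tail_le r : (strip_tail r <= l r)%N.
Proof.
have [d] := ubnP (m - r)%N; elim: d r => // d IH r rd.
have [rm|mr] := ltnP r m; last by rewrite /strip_tail big_geq.
have IHr : (strip_tail r.+1 <= l r.+1)%N by apply: IH; lia.
by rewrite strip_tailS; move: (al r) (la r) IHr; lia.
Qed.

Lemma strip_tail_anti r s : (r <= s)%N -> (strip_tail s <= strip_tail r)%N.
Proof.
move=> /subnKC <-; elim: (s - r)%N => [|d IH]; first by rewrite addn0.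
by apply: leq_trans IH; rewrite addnS [X in (_ <= X)%N]strip_tailS leq_addl.
Qed.

Lemma a_anti r s : (r <= s)%N -> (a s <= a r)%N.
Proof.
move=> /subnKC <-; elim: (s - r)%N => [|d IH]; first by rewrite addn0.
by rewrite addnS (leq_trans (al _)) // (leq_trans (la _)).
Qed.

(** Together with [strip_tail_anti], this monotonicity of a_r - b_r makes the vectors whose r-th
    component is divisible by t^(b_r) a submodule independent of the choice of Jordan
    coordinates. *)
Lemma strip_gap_anti r s : (r <= s)%N ->
  (a s + strip_tail r.+1 <= a r + strip_tail s.+1)%N.
Proof.
move=> /subnKC <-; elim: (s - r)%N => [|d IH]; first by rewrite addn0.
rewrite addnS; move: (al (r + d).+1) (la (r + d)) IH (strip_tailS (r + d).+1); lia.
Qed.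

(** It compares the ranks of k-th powers in types [l] and [a]: rows before [i] contribute their
    whole strip, row [i] the part of l_i beyond [k], later rows nothing because l_(j+1) <= a_j <=
    k. *)
Lemma strip_sums k i :
  (forall j, (j < i)%N -> (k <= a j)%N) -> (forall j, (i <= j)%N -> (a j <= k)%N) ->
  (\sum_(0 <= j < m) (l j - k) + strip_tail i =
   \sum_(0 <= j < m) (a j - k) + strip_tail 0 + (l i - k))%N.
Proof.
move=> lo hi.
have zero (f : nat -> nat) r : (forall j, (r <= j)%N -> f j = 0%N) ->
    (\sum_(r <= j < m) f j = 0)%N.
  by move=> f0; rewrite big_nat big1 // => j /andP[/f0].
have l0k j : (m <= j)%N -> (l j - k = 0)%N by move=> /l0 ->.
have a0k j : (m <= j)%N -> (a j - k = 0)%N by move=> /a0 ->.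
suff H d : (d <= i)%N ->
    (\sum_(i - d <= j < m) (l j - k) + strip_tail i =
     \sum_(i - d <= j < m) (a j - k) + strip_tail (i - d) + (l i - k))%N.
  by have := H i (leqnn i); rewrite subnn.
elim: d => [_|d IH di].
  rewrite subn0 (sum_tailS _ l0k) (zero (fun j => l j - k)%N) => [|j ij].
    rewrite (zero (fun j => a j - k)%N) => [|j ij]; first by lia.
    by have := hi _ ij; lia.
  have hj : (a j.-1 <= k)%N by apply: hi; lia.
  by have := la j.-1; rewrite prednK; lia.
have := IH (ltnW di); have -> : (i - d = (i - d.+1).+1)%N by lia.
rewrite (sum_tailS (i - d.+1) l0k) (sum_tailS (i - d.+1) a0k) (strip_tailS (i - d.+1)).
have lod : (k <= a (i - d.+1))%N by apply: lo; lia.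
by have := al (i - d.+1)%N; lia.
Qed.

End Interlacing.

(** * The Jordan type of the extension in terms of its class *)

Section ExtensionType.
Variables (F : fieldType) (n p m : nat) (N : 'M[F]_n) (C : 'M[F]_(p, n)).
Variables (sa sl : seq nat).
Local Notation a := (nth 0%N sa).
Local Notation l := (nth 0%N sl).
Hypotheses (size_a : size sa = m) (size_l : size sl = m).
Hypotheses (sum_a : sumn sa = n) (sum_l : sumn sl = (n + p)%N).
Hypothesis al : forall j, (a j <= l j)%N.
Hypothesis la : forall j, (l j.+1 <= a j)%N.
Local Notation tail := (strip_tail a l m).
Local Notation idx := (reshape_index sa).
Local Notation off := (reshape_offset sa).
Local Notation J := (jordan_mx F n sa).
Variables (h : 'M[F]_n) (d : F) (z : 'rV[F]_n).
Hypotheses (h_unit : h \in unitmx) (hN : h *m N = J^T *m h).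
Hypotheses (d0 : d != 0) (zh : z *m h = d *: ext_class N C).

Lemma part0a j : (m <= j)%N -> a j = 0%N.
Proof. by move=> mj; rewrite nth_default ?size_a. Qed.

Lemma part0l j : (m <= j)%N -> l j = 0%N.
Proof. by move=> mj; rewrite nth_default ?size_l. Qed.

Lemma hNX k : h *m N ^+ k = J^T ^+ k *m h.
Proof. exact: intertwine_expr. Qed.

Lemma ext_class_sub j k :
  (ext_class N C *m N ^+ j <= N ^+ k)%MS <->
  (forall i : 'I_n, (j <= off i)%N -> (a (idx i) + j <= off i + k)%N -> z 0 i = 0).
Proof.
rewrite -jordan_tr_sub // -[(z *m _ <= _)%MS](submxMfree _ _ (C := h)) ?row_free_unit //.
rewrite -mulmxA -!hNX mulmxA zh -scalemxAl eqmx_scale //.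
by rewrite (eqmxMfull (N ^+ k)) ?row_full_unit.
Qed.

Lemma sumn_nth (s : seq nat) : sumn s = (\sum_(0 <= r < size s) nth 0%N s r)%N.
Proof. by rewrite sumnE (big_nth 0%N). Qed.

Lemma strip_tail0 : tail 0 = p.
Proof.
have := sum_l; rewrite -sum_a !sumn_nth size_a size_l /strip_tail => E.
apply/eqP; rewrite -(eqn_add2l (\sum_(0 <= r < m) a r)) -E -big_split /=.
by apply/eqP/eq_bigr => r _; rewrite subnKC.
Qed.

Lemma rank_a k : \rank (N ^+ k) = (\sum_(0 <= r < m) (a r - k))%N.
Proof.
transitivity (\rank (h *m N ^+ k)); first by rewrite eqmxMfull ?row_full_unit.
rewrite hNX mxrankMfree ?row_free_unit // -size_a -(rank_jordan_mxX F sum_a k).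
by rewrite -[RHS]mxrank_tr trmx_expr.
Qed.

Local Notation E := (block_mx N 0 C (shift_mx F p)).

Lemma ext_type_zero :
  (forall k, \rank (E ^+ k) = (\sum_(0 <= r < m) (l r - k))%N) ->
  forall i : 'I_n, (a (idx i) <= off i + tail (idx i).+1)%N -> z 0 i = 0.
Proof.
move=> rE i le.
(* At the exponent k = a_r, with r the block of [i], the prescribed rank forces o = a_r - b_r. *)
have [o [kpo /ext_class_sub uo _ rEo]] := rank_ext N C (a (idx i)).
have := strip_sums part0a part0l al la (k := a (idx i)) (i := idx i).
rewrite strip_tail0 (strip_tailS _ part0l) -rE -rank_a => H.
have {H} := H (fun j ji => a_anti al la (ltnW ji)) (fun j ij => a_anti al la ij).
have := al (idx i); move: rEo => rEo al_i rEt.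
by apply: uo; lia.
Qed.

Lemma ext_type_generic :
  (forall i : 'I_n, (a (idx i) <= off i + tail (idx i).+1)%N -> z 0 i = 0) ->
  (forall i : 'I_n, (off i + tail (idx i).+1).+1 = a (idx i) ->
     (tail (idx i).+1 < p)%N -> z 0 i != 0) ->
  forall k, \rank (E ^+ k) = (\sum_(0 <= r < m) (l r - k))%N.
Proof.
move=> z0 zn k; have [o [kpo /ext_class_sub uo nu rEo]] := rank_ext N C k.
have ex : exists i, (a i <= k)%N by exists m; rewrite part0a.
case: (ex_minnP ex) => i aik imin {ex}.
have lo j : (j < i)%N -> (k < a j)%N.
  by move=> ji; rewrite ltnNge; apply/negP => /imin; rewrite leqNgt ji.
have hi j : (i <= j)%N -> (a j <= k)%N by move=> ij; apply: leq_trans (a_anti al la ij) aik.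
have := strip_sums part0a part0l al la (fun j ji => ltnW (lo j ji)) hi.
rewrite strip_tail0 -rank_a => sumE.
have tS r : tail r = (l r - a r + tail r.+1)%N by apply: strip_tailS _ part0l r.
have tle r : (tail r <= l r)%N by apply: strip_tail_le part0l al la r.
have tp : (tail i <= p)%N by rewrite -strip_tail0; apply: (strip_tail_anti a part0l (leq0n i)).
(* The rank formula is equivalent to this value of [o]. The vanishing coefficients bound [o] from
   above, the nonzero coefficients of t^(b_r) from below. *)
have oE : (o + tail i = maxn k (l i))%N; last by move: oE rEo sumE; lia.
apply/eqP; rewrite eqn_leq; apply/andP; split.
  rewrite leqNgt; apply/negP => lt.
  have := nu (maxn k (l i) - tail i)%N; rewrite (_ : _ && _); last first.
    by have := tle i; lia.
  move=> /(_ isT) /negP; apply; apply/ext_class_sub => x ox ax; apply: z0.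
  have [xi|ix] := ltnP (idx x) i.
    by have := strip_tail_anti a part0l xi; have := tle i; lia.
  have := strip_gap_anti part0l al la ix; have := tle i; have := tS i.
  have := hi _ ix; have := al i; lia.
rewrite leqNgt; apply/negP => lt.
(* Too small an [o] would kill the coefficient of t^(b_r) in block r. Row [i] gives the
   contradiction if l_i > k, and row i - 1 otherwise. *)
have witness r : (tail r.+1 < a r)%N -> (tail r.+1 < p)%N -> (o < a r - tail r.+1)%N ->
    (a r + o < a r - tail r.+1 + k)%N \/ (a r <= k)%N -> False.
  move=> ta tap oa ak.
  have [x [xr xo]] : exists x : 'I_n, idx x = r /\ off x = (a r - tail r.+1).-1.
    by apply: idx_off_ex => //; lia.
  have zx : z 0 x != 0 by apply: zn; rewrite xr ?xo; lia.
  by case/eqP: zx; apply: uo; rewrite ?xr ?xo; lia.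
have := al i; have := tS i; have := tle i; move=> tlei tSi ali.
have [lk|kl] := leqP (l i) k; last by apply: (witness i); lia.
have i0 : (0 < i)%N.
  rewrite lt0n; apply/eqP => i0; move: lt kpo; rewrite i0 strip_tail0; rewrite i0 in lk.
  by lia.
have ka : (k < a i.-1)%N by apply: lo; lia.
by apply: (witness i.-1); rewrite prednK //; lia.
Qed.

(** It frees the vanishing conditions from the intertwiner [h], so that they define one bundle over
    the whole base. Monotonicity of b_r and of a_r - b_r makes the conditions at the different
    blocks compatible. *)
Lemma ext_zero_sub :
  (forall r, (r < m)%N ->
     (ext_class N C *m N ^+ (a r - tail r.+1) <= N ^+ (a r))%MS) <->
  (forall i : 'I_n, (a (idx i) <= off i + tail (idx i).+1)%N -> z 0 i = 0).
Proof.
split=> [sub i le|z0 r rm].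
  have im : (idx i < m)%N.
    by rewrite ltnNge; apply/negP => /part0a ai; have := off_lt sum_a i; rewrite ai.
  by have /ext_class_sub := sub _ im; apply; lia.
apply/ext_class_sub => i oi ai; apply: z0.
have tr : (tail r.+1 <= a r)%N.
  by apply: leq_trans (la r); apply: strip_tail_le part0l al la _.
have [ir|ri] := leqP (idx i) r.
  by have := strip_tail_anti a part0l (ir : (idx i).+1 <= r.+1)%N; lia.
by have := strip_gap_anti part0l al la (ltnW ri); lia.
Qed.

End ExtensionType.

(** * Polynomial Jordan coordinates and surjectivity of the class map *)

Section LocalIntertwiner.
Variables (F : fieldType) (T : Type) (k : nat) (c : T -> 'rV[F]_k) (n : nat).
Variables (N : T -> 'M[F]_n) (K : 'M[F]_n) (Y : T -> Prop).
Hypothesis Np : polymap c N.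
Hypothesis simN : forall t, Y t -> exists2 h, h \in unitmx & h *m N t = K *m h.

(* The intertwiners between N t and K form the kernel of a matrix that depends
   polynomially on t and whose rank is the same for all t in Y. *)
Lemma local_intertwiner t0 : Y t0 ->
  exists (h : T -> 'M[F]_n) (delta : T -> F),
    [/\ polymap c h, polyfun c delta, delta t0 != 0
      & forall t, Y t -> delta t != 0 -> h t \in unitmx /\ h t *m N t = K *m h t].
Proof.
move=> Yt0; pose M t := lin_mulmxr (N t) - lin_mulmx K : 'M[F]_(n * n).
have ME t X : mxvec X *m M t = mxvec (X *m N t - K *m X).
  by rewrite mulmxBr !mul_vec_lin linearB.
have Mp : polymap c M.
  apply: polymapB; last exact: polymap_const.
  move=> i j; suff P : polymap c (fun t => mxvec (vec_mx (delta_mx 0 i : 'rV_(n * n)) *m N t)).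
    by apply: eq_polyfun (P 0 j) => t; rewrite !mxE.
  by apply: polymap_mxvec; apply: polymapM => //; apply: polymap_const.
pose M0 := lin_mulmxr K - lin_mulmx K : 'M[F]_(n * n).
have rM t : Y t -> \rank (M t) = \rank M0.
  move=> /simN[h hu hN].
  have conj : lin_mulmxr h *m M t = M0 *m lin_mulmxr h.
    apply/row_matrixP => i; rewrite !rowE !mulmxA -(vec_mxK (delta_mx 0 i)).
    rewrite mul_vec_lin /= ME mulmxBr !mul_vec_lin /= -linearB /= mul_vec_lin /=.
    by rewrite mulmxBl -!mulmxA hN.
  have Lu : (lin_mulmxr h : 'M[F]_(n * n)) \in unitmx.
    have E : lin_mulmxr h *m lin_mulmxr (invmx h) = 1%:M :> 'M[F]_(n * n).
      apply/row_matrixP => i; rewrite !rowE mulmxA mulmx1 -(vec_mxK (delta_mx 0 i)).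
      by rewrite !mul_vec_lin /= mulmxK.
    by have [] := mulmx1_unit E.
  transitivity (\rank ((lin_mulmxr h : 'M[F]_(n * n)) *m M t)).
    by rewrite eqmxMfull ?row_full_unit.
  by rewrite conj mxrankMfree ?row_free_unit.
have [h0 h0u h0N] := simN Yt0.
have ker0 : mxvec h0 *m M t0 = 0 by rewrite ME h0N subrr linear0.
have [x [delta [xp dp x0 d0 xM]]] := kernel_section Mp rM Yt0 ker0.
have hp : polymap c (fun t => vec_mx (x t)) by apply: polymap_vec.
exists (fun t => vec_mx (x t)), (fun t => delta t * \det (vec_mx (x t))); split=> //.
- by apply: polyfunM => //; apply: polyfun_det.
- by rewrite mulf_neq0 // x0 mxvecK -unitfE -unitmxE.
move=> t Yt; rewrite mulf_eq0 negb_or => /andP[dt det]; split.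
  by rewrite unitmxE unitfE.
have := xM _ Yt dt; rewrite -{1}(vec_mxK (x t)) ME => /(congr1 vec_mx).
by rewrite mxvecK linear0 => /eqP; rewrite subr_eq0 => /eqP.
Qed.

End LocalIntertwiner.

Section ExtensionMatrix.
Variables (F : fieldType) (n p q : nat) (N : 'M[F]_n) (V : 'M[F]_(q, n)).

Definition ext_mx : 'M[F]_(p * q, n) :=
  \sum_(b < p) lin1_mx (row b \o vec_mx) *m V *m N ^+ b.

Lemma ext_mxE w : w *m ext_mx = ext_class N (vec_mx w *m V).
Proof.
rewrite mulmx_sumr; apply: eq_bigr => b _.
by rewrite !mulmxA mul_rV_lin1 /= row_mul.
Qed.

Hypothesis gen : forall x : 'rV_n, exists w y, x = w *m V + y *m N.

(** Iterating [gen] p times pushes the remainder into the image of N^p: the class map is onto V /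
    t^p V. *)
Lemma ext_mx_surj (x : 'rV[F]_n) : exists w y, x = w *m ext_mx + y *m N ^+ p.
Proof.
have step e : exists (w : nat -> 'rV_q) y,
    x = \sum_(0 <= b < e) w b *m V *m N ^+ b + y *m N ^+ e.
  elim: e => [|e [w [y xE]]].
    by exists (fun=> 0), x; rewrite big_geq // expr0 mulmx1 add0r.
  have [w0 [y0 yE]] := gen y; exists (fun b => if (b < e)%N then w b else w0), y0.
  rewrite xE yE big_nat_recr //= ltnn mulmxDl addrA exprS -mulmxE mulmxA; congr (_ + _ + _).
  by apply: eq_big_nat => b /andP[_ ->].
have [w [y xE]] := step p.
exists (mxvec (\matrix_(b < p) w b)), y; rewrite ext_mxE mxvecK xE big_mkord; congr (_ + _).
by apply: eq_bigr => b _; rewrite row_mul rowK.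
Qed.

(** The selected coordinates are the coefficients of t^e with e < p. They do not see the image of
    N^p, so surjectivity modulo that image lets them be prescribed freely. *)
Lemma ext_coord_surj sa (h : 'M[F]_n) (t : 'rV[F]_n) :
  sumn sa = n -> h \in unitmx -> h *m N = (jordan_mx F n sa)^T *m h ->
  exists w : 'rV[F]_(p * q), forall i : 'I_n,
    (nth 0%N sa (reshape_index sa i) <= reshape_offset sa i + p)%N ->
    (w *m ext_mx *m \adj h) 0 i = t 0 i.
Proof.
move=> sum_a hu hN; set J := jordan_mx F n sa in hN *.
have hNX k := intertwine_expr k hN.
have d0 : \det h != 0 by rewrite -unitfE -unitmxE.
have [w [y wE]] := ext_mx_surj ((\det h)^-1 *: (t *m h)).
exists w => i le.
have yE : y *m N ^+ p *m \adj h = y *m invmx h *m J^T ^+ p *m (h *m \adj h).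
  by rewrite !mulmxA; congr (_ *m _); rewrite -[RHS]mulmxA -hNX -mulmxA mulKmx.
have := congr1 (fun u => (u *m \adj h) 0 i) wE.
rewrite /= -scalemxAl -[t *m h *m _]mulmxA mul_mx_adj mul_mx_scalar scalerA mulVf // scale1r.
rewrite mulmxDl yE mul_mx_adj mul_mx_scalar => ->.
by rewrite [RHS]mxE [X in _ + X]mxE jordan_tr_zero // mulr0 addr0.
Qed.

End ExtensionMatrix.

(** * The stages of X_circ *)

Section BlockStep.
Variables (F : numFieldType) (NN n p q m d : nat) (sa sl : seq nat).
Variables (R : 'M[F]_(NN, q)) (K : 'M[F]_(p, NN)) (J0 : 'M[F]_NN) (V : 'M[F]_(q, n)).
Variables (len : (n <= NN)%N) (Y E : set 'M[F]_NN).
Local Notation a := (nth 0%N sa).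
Local Notation l := (nth 0%N sl).
Hypotheses (size_a : size sa = m) (size_l : size sl = m).
Hypotheses (sum_a : sumn sa = n) (sum_l : sumn sl = (n + p)%N).
Hypothesis al : forall j, (a j <= l j)%N.
Hypothesis la : forall j, (l j.+1 <= a j)%N.
Local Notation tail := (strip_tail a l m).
Local Notation idx := (reshape_index sa).
Local Notation off := (reshape_offset sa).

Definition block_part (B : 'M[F]_NN) : 'M[F]_n :=
  (mxsub (widen_ord len) (widen_ord len) B)^T.
(** The columns of [R] and the rows of [K] pick the rows and columns of the new free entries, and
    [J0] holds the values of these entries on [Y]. *)
Definition block_coord A : 'rV[F]_(p * q) := mxvec (R^T *m (A - J0) *m K^T)^T.
Definition block_emb B (w : 'rV[F]_(p * q)) := B + R *m (vec_mx w)^T *m K.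
Definition block_ret A := A - R *m (R^T *m (A - J0) *m K^T) *m K.

Hypothesis RR : R^T *m R = 1%:M.
Hypothesis KK : K *m K^T = 1%:M.
Hypothesis Y_coord : forall B, Y B -> R^T *m (B - J0) *m K^T = 0.
Hypothesis Y_orbit : forall B, Y B ->
  exists2 h, h \in unitmx & h *m block_part B = (jordan_mx F n sa)^T *m h.
Hypothesis Y_gen : forall B, Y B -> forall x : 'rV_n,
  exists w y, x = w *m V + y *m block_part B.
Hypothesis E_ret : forall A, E A -> Y (block_ret A).
Hypothesis E_emb : forall B w, Y B -> (E (block_emb B w) <->
  forall k, \rank (block_mx (block_part B) 0 (vec_mx w *m V) (shift_mx F p) ^+ k) =
    (\sum_(0 <= r < m) (l r - k))%N).

Lemma block_partp : mpolymap block_part.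
Proof.
move=> i j; have := @mpolymap_id F NN (widen_ord len j) (widen_ord len i).
by apply: eq_polyfun => B; rewrite !mxE.
Qed.

Lemma block_coordp : mpolymap block_coord.
Proof.
apply: polymap_mxvec => i j; suff P : mpolymap (fun A : 'M[F]_NN => R^T *m (A - J0) *m K^T).
  by have := P j i; apply: eq_polyfun => A; rewrite [RHS]mxE.
apply: polymapM; last exact: polymap_const.
apply: polymapM; first exact: polymap_const.
by apply: polymapB; [apply: mpolymap_id | apply: polymap_const].
Qed.

Lemma block_retp : mpolymap block_ret.
Proof.
apply: polymapB; first exact: mpolymap_id.
apply: polymapM; last exact: polymap_const.
apply: polymapM; first exact: polymap_const.
apply: polymapM; last exact: polymap_const.
apply: polymapM; first exact: polymap_const.
by apply: polymapB; [apply: mpolymap_id | apply: polymap_const].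
Qed.

Lemma block_embp (S : Type) (k : nat) (e : S -> 'rV[F]_k) B w :
  polymap e B -> polymap e w -> polymap e (fun s => block_emb (B s) (w s)).
Proof.
move=> Bp wp; apply: polymapD => //; apply: polymapM; last exact: polymap_const.
apply: polymapM; first exact: polymap_const.
by move=> i j; apply: eq_polyfun (polymap_vec wp j i) => s; rewrite [RHS]mxE.
Qed.

Lemma block_retK A : block_emb (block_ret A) (block_coord A) = A.
Proof. by rewrite /block_emb mxvecK trmxK subrK. Qed.

Lemma block_embK B w : Y B ->
  block_ret (block_emb B w) = B /\ block_coord (block_emb B w) = w.
Proof.
move=> YB; have E0 : R^T *m (block_emb B w - J0) *m K^T = (vec_mx w)^T.
  rewrite /block_emb addrAC mulmxDr mulmxDl Y_coord // add0r.
  by rewrite !mulmxA RR mul1mx -mulmxA KK mulmx1.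
by rewrite /block_ret /block_coord E0 trmxK vec_mxK addrK.
Qed.

Lemma card_constrained :
  #|[pred i : 'I_n | (a (idx i) <= off i + tail (idx i).+1)%N]| =
  (\sum_(0 <= r < m) tail r.+1)%N.
Proof.
rewrite -sum1_card big_mkcond /=.
have := sum_reshape sa (fun r c => if (a r <= c + tail r.+1)%N then 1%N else 0%N).
rewrite sum_a => ->; rewrite size_a big_mkord; apply: eq_bigr => r _.
have tr : (tail r.+1 <= a r)%N.
  by apply: leq_trans (la r); apply: strip_tail_le (part0l size_l) al la _.
rewrite -(big_mkord xpredT (fun c => if (a r <= c + tail r.+1)%N then 1%N else 0%N)).
rewrite (big_cat_nat (n := a r - tail r.+1)%N) ?leq_subr //=.
rewrite big_nat big1 ?add0n => [|c ck]; last by rewrite ifF //; lia.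
rewrite big_nat (eq_bigr (fun=> 1%N)) => [|c ck]; last by rewrite ifT //; lia.
by rewrite -big_nat sum_nat_const_nat muln1 subKn.
Qed.

Let L B (w : 'rV[F]_(p * q)) := forall r, (r < m)%N ->
  (ext_class (block_part B) (vec_mx w *m V) *m block_part B ^+ (a r - tail r.+1)
     <= block_part B ^+ (a r))%MS.

Let zed h B (w : 'rV[F]_(p * q)) : 'rV[F]_n := w *m ext_mx p (block_part B) V *m \adj h.

Let zedh h B w : zed h B w *m h = \det h *: ext_class (block_part B) (vec_mx w *m V).
Proof. by rewrite /zed -mulmxA mul_adj_mx mul_mx_scalar ext_mxE. Qed.

(** [S] indexes the coefficients of t^e with e < b_r, which have to vanish, and [Q] those of t^(b_r)
    with b_r < p, whose nonvanishing then suffices for type [l]. *)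
Let S := [pred i : 'I_n | (a (idx i) <= off i + tail (idx i).+1)%N].
Let Q := [pred i : 'I_n | ((off i + tail (idx i).+1).+1 == a (idx i)) &&
                          (tail (idx i).+1 < p)%N].

Let det_unit (h : 'M[F]_n) : h \in unitmx -> \det h != 0.
Proof. by rewrite unitmxE unitfE. Qed.

Let L_zed h B w : h \in unitmx -> h *m block_part B = (jordan_mx F n sa)^T *m h ->
  (L B w <-> forall i, i \in S -> zed h B w 0 i = 0).
Proof.
move=> hu hN.
exact: (ext_zero_sub size_a size_l sum_a sum_l al la hu hN (det_unit hu) (zedh h B w)).
Qed.

Let E_L B w : Y B -> E (block_emb B w) -> L B w.
Proof.
move=> YB /E_emb-/(_ YB) rk; have [h hu hN] := Y_orbit YB.
apply/(L_zed _ hu hN).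
exact: (ext_type_zero size_a size_l sum_a sum_l al la hu hN (det_unit hu) (zedh h B w)).
Qed.

Let coord_surj h B (t : 'rV[F]_n) : Y B -> h \in unitmx ->
  h *m block_part B = (jordan_mx F n sa)^T *m h ->
  exists w, forall i, i \in S \/ i \in Q -> zed h B w 0 i = t 0 i.
Proof.
move=> YB hu hN; have [w wt] := ext_coord_surj p (Y_gen YB) t sum_a hu hN.
have tp r : (tail r <= p)%N.
  rewrite -(strip_tail0 size_a size_l sum_a sum_l al).
  exact: (strip_tail_anti a (part0l size_l) (leq0n r)).
exists w => i; rewrite !inE => iSQ; apply: wt.
by case: iSQ => [iS|/andP[/eqP iQ tq]]; have := tp (idx i).+1; lia.
Qed.

Lemma block_step : rational_chart Y d ->
  rational_chart E (d + (p * q - \sum_(0 <= r < m) tail r.+1)) /\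
  (\sum_(0 <= r < m) tail r.+1 <= p * q)%N.
Proof.
move=> Yd; rewrite -card_constrained -/S.
have M_exists B0 : Y B0 -> exists (delta : 'M[F]_NN -> F) (h : 'M[F]_NN -> 'M[F]_n),
  [/\ mpolymap h, mpolyfun delta, delta B0 != 0
    & forall B, Y B -> delta B != 0 ->
        h B \in unitmx /\ h B *m block_part B = (jordan_mx F n sa)^T *m h B].
  by move=> YB0; have [h [delta H]] := local_intertwiner block_partp Y_orbit YB0; exists delta, h.
pose M h B : 'M[F]_(p * q, #|S|) :=
  colsub (@enum_val _ S) (ext_mx p (block_part B) V *m \adj h).
have ME h B w j : (w *m M h B) 0 j = zed h B w 0 (enum_val j).
  by rewrite /zed -mulmxA mxE [RHS]mxE; apply: eq_bigr => k _; rewrite [in LHS]mxE.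
have Mrank h B : Y B -> h \in unitmx -> h *m block_part B = (jordan_mx F n sa)^T *m h ->
    \rank (M h B) = #|S|.
  move=> YB hu hN; apply/eqP; rewrite -/(row_full (M h B)) -sub1mx.
  apply/row_subP => k; set y := row k _.
  have [w wt] := coord_surj (\row_i (\sum_(j | enum_val j == i) y 0 j)) YB hu hN.
  apply/submxP; exists w; apply/rowP => j; rewrite ME wt; last by left; apply: enum_valP.
  by rewrite [RHS]mxE (big_pred1 j) // => j'; rewrite (inj_eq enum_val_inj).
(* The inequality makes the truncated difference a true one; it holds because a matrix with [p * q]
   rows attains the rank [#|S|]. *)
split; last first.
  have [sigma [f [eta [pi [_ [[x0 fx0] Ys _ _]]]]]] := Yd.
  have [h hu hN] := Y_orbit (Ys _ fx0).
  by rewrite -(Mrank h _ (Ys _ fx0) hu hN) rank_leq_row.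
apply: (bundle_chart (L := L) block_retp block_coordp block_embp _ block_embK _ Yd).
  move=> A EA; have YA := E_ret EA; split=> //; last exact: block_retK.
  by apply: E_L => //; rewrite block_retK.
move=> B0 YB0; have [delta [h [hp dp d0 hN]]] := M_exists _ YB0.
pose g A := \prod_(i | i \in Q) zed (h (block_ret A)) (block_ret A) (block_coord A) 0 i.
have extp : mpolymap (fun B => ext_mx p (block_part B) V).
  apply: polymap_sum => b; apply: polymapM; first exact: polymap_const.
  exact/polymapX/block_partp.
have gp : mpolyfun g.
  apply: polyfun_prod => i.
  suff P : mpolymap (fun A => zed (h (block_ret A)) (block_ret A) (block_coord A)) by exact: P.
  have retp := polymap_mxvec block_retp.
  apply: polymapM; first apply: polymapM; first exact: block_coordp.
    exact: polymap_comp extp retp.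
  exact: polymap_comp (polymap_adj hp) retp.
have gE B w : Y B -> g (block_emb B w) = \prod_(i | i \in Q) zed (h B) B w 0 i.
  by move=> YB; rewrite /g; have [-> ->] := block_embK w YB.
have [hu0 hN0] := hN _ YB0 d0.
(* This fibre point has coordinates 0 on [S] and 1 on [Q], so it lies in [L B0] and [g] does not
   vanish there. *)
have [w1 w1t] := coord_surj (\row_i (i \notin S)%:R) YB0 hu0 hN0.
exists delta, (fun B => M (h B) B), g, w1; split; first split=> //.
  move=> i j; have P := polymapM extp (polymap_adj hp).
  by apply: eq_polyfun (P i (enum_val j)) => B; rewrite [RHS]mxE.
split.
- by move=> B YB dB; have [hu hNB] := hN _ YB dB; apply: Mrank.
- move=> B w YB dB; have [hu hNB] := hN _ YB dB; rewrite (L_zed _ hu hNB).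
  split=> [z0|wM i iS]; first by apply/rowP => j; rewrite ME z0 ?mxE //; apply: enum_valP.
  by rewrite -(enum_rankK_in iS iS) -ME wM mxE.
- split; first by apply/(L_zed _ hu0 hN0) => i iS; rewrite w1t ?mxE ?iS //; left.
  rewrite gE //; apply/prodf_neq0 => i iQ; rewrite w1t; last by right.
  rewrite mxE; suff -> : i \notin S by rewrite oner_eq0.
  by move: iQ; rewrite !inE => /andP[/eqP iQ _]; lia.
move=> B w YB dB LBw gBw; have [hu hNB] := hN _ YB dB.
apply/E_emb => //.
apply: (ext_type_generic size_a size_l sum_a sum_l al la hu hNB (det_unit hu) (zedh (h B) B w)).
  by apply/(L_zed _ hu hNB).
move=> i iQ tq; move: gBw; rewrite gE // => /prodf_neq0; apply.
by rewrite inE iQ eqxx.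
Qed.

End BlockStep.

Section Stages.
Variables (F : numFieldType) (N m : nat) (mu : seq nat) (tau : seq (seq nat)).
Hypotheses (size_mu : size mu = m) (sum_mu : sumn mu = N).
Hypothesis mu_anti : forall j k, (j <= k)%N -> (nth 0%N mu k <= nth 0%N mu j)%N.
Hypothesis mu_pos : forall k, (k < m)%N -> (0 < nth 0%N mu k)%N.
Local Notation part := (nth 0%N mu).
Local Notation idx := (reshape_index mu).
Local Notation off := (reshape_offset mu).
Local Notation J := (jordan_mx F N mu).
Local Notation start i := (sumn (take i mu)).

Lemma startS i : start i.+1 = (start i + part i)%N.
Proof.
have [im|mi] := ltnP i (size mu); first by rewrite (take_nth 0%N) // sumn_rcons.
by rewrite !take_oversize ?nth_default ?addn0 // ltnW.
Qed.

Lemma start_le i j : (i <= j)%N -> (start i <= start j)%N.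
Proof.
move=> /subnKC <-; elim: (j - i)%N => [|k IH]; rewrite ?addn0 //.
by rewrite addnS startS (leq_trans IH) ?leq_addr.
Qed.

Lemma start_size : start m = N.
Proof. by rewrite -size_mu take_size. Qed.

Lemma start_leN i : (start i <= N)%N.
Proof.
have [im|/ltnW mi] := leqP i m; first by rewrite -start_size start_le.
by rewrite take_oversize ?sum_mu ?size_mu.
Qed.

Lemma idx_off (r : 'I_N) : (r : nat) = (start (idx r) + off r)%N.
Proof. by rewrite -[LHS](reshape_indexK mu r). Qed.

Lemma idx_lt (r : 'I_N) : (idx r < m)%N.
Proof. by rewrite -size_mu; apply/reshape_indexP/ord_sumn. Qed.

Lemma idx_lt_start (r : 'I_N) i : (r < start i)%N = (idx r < i)%N.
Proof.
have rE := idx_off r; have := off_lt sum_mu r => ro.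
have [ri|ir] := ltnP (idx r) i.
  by apply: leq_trans (start_le ri); rewrite startS {1}rE ltn_add2l.
by apply/negbTE; rewrite -leqNgt; apply: leq_trans (start_le ir) _; rewrite [leqRHS]rE leq_addr.
Qed.

Lemma ltn_ord_idx (r c : 'I_N) :
  (r < c)%N = (idx r < idx c)%N || (idx r == idx c) && (off r < off c)%N.
Proof.
have [rc|cr|e] := ltngtP (idx r) (idx c).
- apply/idP; apply: (@leq_trans (start (idx c))); first by rewrite idx_lt_start.
  by rewrite [leqRHS]idx_off leq_addr.
- apply/negbTE; rewrite -leqNgt; apply/ltnW.
  by apply: (@leq_trans (start (idx r))); rewrite ?idx_lt_start // [leqRHS]idx_off leq_addr.
- have -> : (r < c)%N = (start (idx r) + off r < start (idx c) + off c)%N by rewrite -!idx_off.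
  by rewrite e ltn_add2l.
Qed.

(* The entries in which a strictly upper triangular element of the slice can differ
   from the Jordan matrix. *)
Definition slice_entry (r c : 'I_N) := ((off r).+1 == part (idx r)) && (idx r < idx c)%N.

(** As [mu] is weakly decreasing, the second vanishing condition of the slice never meets an entry
    with [idx r < idx c], so these entries of the last rows are free; triangularity kills the other
    entries of the last rows. *)
Lemma slice_upperP (A : 'M[F]_N) :
  slice_T mu A /\ strictly_upper A <-> (forall r c : 'I_N, ~~ slice_entry r c -> A r c = J r c).
Proof.
have Jlow (r c : 'I_N) : (c <= r)%N -> J r c = 0.
  move=> cr; rewrite mxE; case: andP => // -[/eqP e /eqP o].
  by move: cr; rewrite leqNgt ltn_ord_idx e eqxx -o ltnSn orbT.
split=> [[AT AU] r c|AJ].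
  have ro := off_lt sum_mu r; rewrite negb_and => /orP[nl|ci].
    apply/eqP; rewrite -subr_eq0; have := AT r c; rewrite !mxE => ->; first by [].
    by left; rewrite ltn_neqAle nl.
  have [lr|nl] := eqVneq (off r).+1 (part (idx r)); last first.
    apply/eqP; rewrite -subr_eq0; have := AT r c; rewrite !mxE => ->; first by [].
    by left; rewrite ltn_neqAle nl.
  have cr : (c <= r)%N.
    rewrite leqNgt ltn_ord_idx (negPf ci) /=; apply/negP => /andP[/eqP e].
    by have := off_lt sum_mu c; rewrite -e -lr ltnS leqNgt => /negP.
  by rewrite AU // Jlow.
split=> [r c /= H|r c cr].
  rewrite !mxE AJ ?mxE ?subrr // negb_and.
  case: H => [lt|[-> /andP[lt1 lt2]]]; first by rewrite (ltn_eqF lt).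
  apply/orP; right; rewrite -leqNgt leqNgt; apply/negP => /ltnW /mu_anti.
  by rewrite leqNgt (leq_trans lt1 lt2).
rewrite AJ ?Jlow // negb_and; apply/orP; right; rewrite -leqNgt.
by move: cr; rewrite leqNgt ltn_ord_idx negb_or -leqNgt => /andP[].
Qed.

Definition orbit_at k (kappa : seq nat) (A : 'M[F]_N) :=
  exists le_kN : (k <= N)%N, nilp_orbit kappa (mxsub (widen_ord le_kN) (widen_ord le_kN) A).

(** The columns of the blocks from [i] on are those of the Jordan matrix, so that all stages live in
    one space of matrices; the first is a point and the last is [X_circ]. *)
Definition stage i : set 'M[F]_N := [set A : 'M[F]_N |
  [/\ forall r c : 'I_N, ~~ slice_entry r c -> A r c = J r c,
      forall r c : 'I_N, (i <= idx c)%N -> A r c = J r c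
    & forall j, (1 <= j <= i)%N -> orbit_at (start j) (tableau_shape tau j) A]].

Lemma stage_X_circ : stage m = X_circ mu tau.
Proof.
apply/seteqP; split=> A /=.
  by move=> [/slice_upperP[AT AU] _ orb]; split=> //; rewrite size_mu.
move=> [AT AU]; rewrite size_mu => orb; split=> //; first exact/slice_upperP.
by move=> r c; rewrite leqNgt idx_lt.
Qed.

Lemma stage0 : stage 0 = [set J].
Proof.
apply/seteqP; split=> A /=; first by move=> [_ AJ _]; apply/matrixP => r c; apply: AJ.
by move=> ->; split=> // j; case: j.
Qed.

Lemma chart_stage0 : rational_chart (stage 0) 0.
Proof.
rewrite stage0; exists (fun=> J), (fun=> 1), (fun=> 1), (fun=> 0).
split; first by split; do ?[exact: polymap_const | exact: polyfun_const].
split=> [|x _ //|x _|q qp q0 A ->]; last exact: (q0 0 (oner_neq0 _)).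
  by exists 0; apply: oner_neq0.
by split; [apply: oner_neq0 | rewrite [x]thinmx0 scaler0].
Qed.

Lemma orbit_at_eq k kappa (A A' : 'M[F]_N) :
  (forall r c : 'I_N, (r < k)%N -> (c < k)%N -> A r c = A' r c) ->
  orbit_at k kappa A -> orbit_at k kappa A'.
Proof.
move=> AA [le H]; exists le; suff <- : mxsub (widen_ord le) (widen_ord le) A =
  mxsub (widen_ord le) (widen_ord le) A' by [].
by apply/matrixP => r c; rewrite !mxE AA /=.
Qed.

Lemma nilp_orbitP n (kappa : seq nat) (A : 'M[F]_n) : sumn kappa = n ->
  nilp_orbit kappa A <->
  (forall k, \rank (A ^+ k) = (\sum_(0 <= r < size kappa) (nth 0%N kappa r - k))%N).
Proof.
move=> sum_k; split=> [[P Pu /(similarP Pu) PA] k|rk].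
  transitivity (\rank (P *m A ^+ k)); first by rewrite eqmxMfull ?row_full_unit.
  by rewrite (intertwine_expr _ PA) mxrankMfree ?row_free_unit // rank_jordan_mxX.
have [|k|P Pu PA] := @nilpotent_similar _ _ A (jordan_mx F n kappa) n.
- apply/eqP; rewrite -mxrank_eq0 rk -sum_k sumn_nth big_nat big1 // => r /andP[_ rs].
  by apply/eqP; rewrite subn_eq0 big_mkord (bigD1 (Ordinal rs)) //= leq_addr.
- by rewrite rk rank_jordan_mxX.
by exists P => //; apply/similarP.
Qed.

Section Step.
Variable i : nat.
Hypothesis im : (i < m)%N.
Local Notation n := (start i).
Local Notation p := (part i).

Let R : 'M[F]_(N, i) := \matrix_(r, s) ((idx r == s) && ((off r).+1 == part s))%:R.
Let K : 'M[F]_(p, N) := \matrix_(b, c) ((idx c == i) && (off c == b))%:R.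
Let V : 'M[F]_(i, n) := \matrix_(s, r) ((idx r == s) && ((off r).+1 == part s))%:R.
Local Notation ret := (block_ret R K J).
Local Notation emb := (block_emb R K).
Local Notation len := (start_leN i).
Local Notation bpart := (block_part len).

Lemma last_ex s : (s < m)%N -> exists r : 'I_N, idx r = s /\ (off r).+1 = part s.
Proof.
move=> sm; have pos := mu_pos sm; have [|r [rs ro]] := @idx_off_ex N mu sum_mu s (part s).-1.
  by rewrite prednK.
by exists r; rewrite ro prednK.
Qed.

Lemma stage_RR : R^T *m R = 1%:M.
Proof.
apply/matrixP => s s'; have [r [rs ro]] := last_ex (ltn_trans (ltn_ord s) im).
rewrite !mxE (bigD1 r) //= !mxE rs ro !eqxx mul1r big1 ?addr0 => [|x xr].
  case: (eqVneq s s') => [->|ss]; first by rewrite !eqxx.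
  by rewrite (inj_eq val_inj) (negPf ss).
rewrite !mxE; case: andP => [[/eqP xs /eqP xo]|_]; last by rewrite mul0r.
case/eqP: xr; apply: (@idx_off_inj N mu); first by rewrite xs rs.
by apply: succn_inj; rewrite xo ro.
Qed.

Lemma stage_KK : K *m K^T = 1%:M.
Proof.
apply/matrixP => b b'; have [c [ci co]] := @idx_off_ex N mu sum_mu i b (ltn_ord b).
rewrite !mxE (bigD1 c) //= !mxE ci co !eqxx mul1r big1 ?addr0 => [|x xc].
  by rewrite (inj_eq val_inj).
rewrite !mxE; case: andP => [[/eqP xi /eqP xo]|_]; last by rewrite mul0r.
by case/eqP: xc; apply: (@idx_off_inj N mu); rewrite ?xi ?xo.
Qed.

Lemma RXK_out X (r c : 'I_N) :
  ~~ [&& idx c == i, (idx r < i)%N & (off r).+1 == part (idx r)] -> (R *m X *m K) r c = 0.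
Proof.
move=> out; rewrite mxE big1 // => b _; rewrite !mxE.
case: andP => [[/eqP ci /eqP cb]|_]; last by rewrite mulr0.
rewrite mulr1 big1 // => s _; rewrite !mxE.
case: andP => [[/eqP rs /eqP ro]|_]; last by rewrite mul0r.
by case/negP: out; rewrite ci eqxx rs ltn_ord ro eqxx.
Qed.

Lemma RXK_in X (r c : 'I_N) (s : 'I_i) (b : 'I_p) :
  idx r = s -> (off r).+1 = part s -> idx c = i -> off c = b -> (R *m X *m K) r c = X s b.
Proof.
move=> rs ro ci cb; rewrite mxE (bigD1 b) //= [K b c]mxE ci cb !eqxx mulr1.
rewrite [X in _ + X]big1 ?addr0 => [|b' bb]; last first.
  by rewrite [K _ _]mxE ci cb eqxx (inj_eq val_inj) eq_sym (negPf bb) mulr0.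
rewrite mxE (bigD1 s) //= mxE rs ro !eqxx mul1r big1 ?addr0 // => s' ss.
by rewrite mxE rs (inj_eq val_inj) eq_sym (negPf ss) mul0r.
Qed.

Lemma RtXKt (X : 'M[F]_N) (r c : 'I_N) (s : 'I_i) (b : 'I_p) :
  idx r = s -> (off r).+1 = part s -> idx c = i -> off c = b -> (R^T *m X *m K^T) s b = X r c.
Proof.
move=> rs ro ci cb; rewrite mxE (bigD1 c) //= [K^T c b]mxE [K b c]mxE ci cb !eqxx mulr1.
rewrite [X in _ + X]big1 ?addr0 => [|c' cc]; last first.
  rewrite [K^T _ _]mxE [K _ _]mxE; case: andP => [[/eqP ci' /eqP cb']|_]; last by rewrite mulr0.
  by case/eqP: cc; apply: (@idx_off_inj N mu); rewrite ?ci ?cb.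
rewrite mxE (bigD1 r) //= [R^T _ _]mxE [R _ _]mxE rs ro !eqxx mul1r big1 ?addr0 // => r' rr.
rewrite [R^T _ _]mxE [R _ _]mxE; case: andP => [[/eqP rs' /eqP ro']|_]; last by rewrite mul0r.
case/eqP: rr; apply: (@idx_off_inj N mu); first by rewrite rs.
by apply: succn_inj; rewrite ro' ro.
Qed.

Lemma stage_coord B : stage i B -> R^T *m (B - J) *m K^T = 0.
Proof.
move=> [_ BJ _]; suff E0 : (B - J) *m K^T = 0 by rewrite -mulmxA E0 mulmx0.
apply/matrixP => r b; rewrite mxE [RHS]mxE big1 // => c _.
have [ci|ci] := eqVneq (idx c) i.
  by rewrite [(B - J) _ _]mxE [(- J) _ _]mxE BJ ?ci // subrr mul0r.
by rewrite [K^T _ _]mxE [K _ _]mxE (negPf ci) mulr0.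
Qed.

Lemma stage_retE (A : 'M[F]_N) (r c : 'I_N) :
  (forall r c : 'I_N, ~~ slice_entry r c -> A r c = J r c) ->
  ret A r c = if idx c == i then J r c else A r c.
Proof.
move=> AJ; rewrite /block_ret mxE [(- _ : 'M_N) _ _]mxE.
case: (eqVneq (idx c) i) => [ci|ci]; last by rewrite RXK_out ?subr0 // (negPf ci).
case: (boolP (slice_entry r c)) => [|ns]; last first.
  rewrite AJ // RXK_out ?subr0 // ci eqxx /=; apply: contra ns => /andP[ri ro].
  by rewrite /slice_entry ro ci ri.
rewrite /slice_entry ci => /andP[/eqP ro ri].
have oc : (off c < p)%N by rewrite -ci off_lt.
rewrite (@RXK_in _ _ _ (Ordinal ri) (Ordinal oc)) // (@RtXKt _ r c) //.
by rewrite [(A - J) _ _]mxE [(- J) _ _]mxE opprB addrC subrK.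
Qed.

Lemma stage_ret A : stage i.+1 A -> stage i (ret A).
Proof.
move=> [AJ AJ2 orb]; split=> [r c ns|r c ic|j /andP[j1 ji]].
- by rewrite stage_retE //; case: ifP => // _; apply: AJ.
- rewrite stage_retE //; case: (eqVneq (idx c) i) => // ci; apply: AJ2.
  by rewrite ltn_neqAle eq_sym ci.
apply: orbit_at_eq (orb j _) => [r c rj|]; last by rewrite j1 ltnW.
rewrite idx_lt_start => cj; rewrite stage_retE // ifF //; apply/negbTE.
by rewrite neq_ltn (leq_trans cj ji).
Qed.

(** The last basis vectors of the blocks generate the module of [J], which is the identity [one];
    and [B] differs from [J] by a [Z] whose rows lie in the row space of [V], so the error can be
    absorbed into [w]. *)
Lemma stage_gen B : stage i B -> forall x : 'rV_n, exists w y, x = w *m V + y *m bpart B.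
Proof.
move=> [BJ _ _] x.
pose w_ := widen_ord len.
pose J' : 'M[F]_n := mxsub w_ w_ J; pose Z : 'M[F]_n := (mxsub w_ w_ (B - J))^T.
have TE : bpart B = J'^T + Z.
  by apply/matrixP => r c; rewrite !mxE addrC subrK.
have wlt (r : 'I_n) : (idx r < i)%N by have := idx_lt_start (w_ r) i; rewrite /= ltn_ord => <-.
have w_inj (r c : 'I_n) : idx r = idx c -> off r = off c -> r = c.
  move=> e o; apply: val_inj; rewrite /=.
  by have := congr1 val (idx_off_inj (e : idx (w_ r) = idx (w_ c)) o).
have VV (r c : 'I_n) : (V^T *m V) r c = ((r == c) && ((off r).+1 == part (idx r)))%:R.
  rewrite mxE (bigD1 (Ordinal (wlt r))) //= !mxE eqxx /= big1 ?addr0 => [|s sr]; last first.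
    rewrite !mxE; case: andP => [[/eqP e _]|_]; last by rewrite mul0r.
    by case/eqP: sr; apply: val_inj => /=.
  case: eqP => [ro|_]; last by rewrite mul0r andbF.
  rewrite mul1r andbT; congr (_%:R); congr nat_of_bool; apply/andP/eqP => [[/eqP e /eqP o]|<-].
    by apply: w_inj => //; apply: succn_inj; rewrite o.
  by rewrite ro !eqxx.
have ZV : Z = Z *m V^T *m V.
  apply/matrixP => c r; rewrite -mulmxA [RHS]mxE (bigD1 r) //= VV eqxx /=.
  rewrite big1 ?addr0 => [|r' rr]; last by rewrite VV (negPf rr) mulr0.
  case: eqP => [_|ro]; first by rewrite mulr1.
  rewrite mulr0 !mxE BJ ?mxE ?subrr //; apply/negP => /andP[/eqP ro' _].
  exact: ro.
have one : 1%:M = V^T *m V + J' *m J'^T.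
  apply/matrixP => r c; rewrite [RHS]mxE VV mxE [X in _ + X]mxE.
  case: (eqVneq (off r).+1 (part (idx r))) => ro.
    rewrite andbT big1 ?addr0 // => y _; rewrite !mxE.
    case: andP => [[/eqP e /eqP o]|_]; last by rewrite mul0r.
    by have := off_lt sum_mu (w_ y); rewrite /= -e -ro o ltnn.
  have ro' : ((off r).+1 < part (idx r))%N by rewrite ltn_neqAle ro (off_lt sum_mu (w_ r)).
  have [y [yi yo]] := idx_off_ex sum_mu ro'.
  have yn : (y < n)%N by rewrite idx_lt_start yi wlt.
  rewrite andbF add0r (bigD1 (Ordinal yn)) //= !mxE /= yi yo !eqxx mul1r.
  rewrite big1 ?addr0 => [|y' yy]; last first.
    rewrite !mxE /=; case: andP => [[/eqP e /eqP o]|_]; last by rewrite mul0r.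
    case/eqP: yy; apply: val_inj => /=.
    have := @idx_off_inj N mu (w_ y') y; rewrite /= -e -o yi yo => /(_ erefl erefl) H.
    by have := congr1 val H.
  congr (_%:R); congr nat_of_bool; apply/eqP/andP => [->|[/eqP e /eqP o]]; first by rewrite !eqxx.
  by apply: w_inj; [rewrite e | apply: succn_inj; rewrite o].
exists (x *m V^T - x *m J' *m Z *m V^T), (x *m J').
have xE : x = x *m V^T *m V + x *m J' *m J'^T by rewrite -!mulmxA -mulmxDr -one mulmx1.
have zE : x *m J' *m Z = x *m J' *m Z *m V^T *m V by rewrite {1}ZV !mulmxA.
by rewrite TE mulmxDr mulmxBl -zE addrACA addNr addr0.
Qed.

Local Notation sa := (tableau_shape tau i).
Local Notation sl := (tableau_shape tau i.+1).

Lemma stage_orbit B : sumn sa = n -> stage i B ->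
  exists2 h, h \in unitmx & h *m bpart B = (jordan_mx F n sa)^T *m h.
Proof.
move=> sum_a [_ _ orb]; have [i0|i0] := posnP i.
  have n0 : n = 0%N by rewrite i0 take0.
  exists 1%:M; first exact: unitmx1.
  by apply/matrixP => r; have := ltn_ord r; rewrite {2}n0.
have [|le [P Pu /(similarP Pu) PA]] := orb i; first by rewrite i0 leqnn.
have tr : (mxsub (widen_ord le) (widen_ord le) B)^T = bpart B.
  by apply/matrixP => r c; rewrite !mxE; congr (B _ _); apply: val_inj.
exists (invmx P^T); first by rewrite unitmx_inv unitmx_tr.
have PTu : P^T \in unitmx by rewrite unitmx_tr.
rewrite -tr; have := congr1 trmx PA; rewrite !trmx_mul => PT.
by rewrite -[LHS](mulmxK PTu) -[_ *m P^T]mulmxA PT mulmxA mulVmx // mul1mx.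
Qed.

Lemma idx_off_start (x : 'I_N) (b : 'I_p) : (x : nat) = (n + b)%N -> idx x = i /\ off x = b.
Proof.
move=> ->; have bp := ltn_ord b.
by split; [exact: flatten_indexKl bp | exact: flatten_indexKr bp].
Qed.

Lemma emb_block B w (le : (n + p <= N)%N) : stage i B ->
  (mxsub (widen_ord le) (widen_ord le) (emb B w))^T =
  block_mx (bpart B) 0 (vec_mx w *m V) (shift_mx F p).
Proof.
move=> [BJ BJ2 _].
have up (r : 'I_n) (x : 'I_N) : (x : nat) = r -> (idx x < i)%N.
  by move=> xr; rewrite -idx_lt_start xr.
have embE (r c : 'I_N) : emb B w r c = B r c + (R *m (vec_mx w)^T *m K) r c by rewrite mxE.
have J0 (r c : 'I_N) : idx r != idx c -> J r c = 0 by move=> /negPf ne; rewrite mxE ne.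
apply/matrixP => r c; rewrite [LHS]mxE [LHS]mxE embE.
case: (split_ordP r) => b ->; case: (split_ordP c) => b' ->.
- rewrite block_mxEul RXK_out ?addr0.
    by rewrite [RHS]mxE [RHS]mxE; congr (B _ _); apply: val_inj.
  by rewrite negb_and neq_ltn (up b).
- rewrite block_mxEur [RHS]mxE RXK_out ?addr0; last by rewrite negb_and neq_ltn (up b).
  have [ci co] := @idx_off_start (widen_ord le (rshift n b')) b' erefl.
  have rlt := up b (widen_ord le (lshift p b)) erefl.
  rewrite BJ ?J0 // ?ci; first by rewrite neq_ltn rlt orbT.
  by rewrite negb_and ci -leqNgt ltnW ?orbT.
- rewrite block_mxEdl; set x := widen_ord le (lshift p b'); set y := widen_ord le (rshift n b).
  have [yi yo] := @idx_off_start y b erefl.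
  have xlt := up b' x erefl.
  rewrite BJ2 ?yi // J0 ?yi ?add0r; last by rewrite neq_ltn xlt.
  rewrite mxE (bigD1 b) //= [K _ _]mxE yi yo !eqxx mulr1.
  rewrite [X in _ + X]big1 ?addr0 => [|b2 bb]; last first.
    by rewrite [K _ _]mxE yi yo eqxx (inj_eq val_inj) eq_sym (negPf bb) mulr0.
  rewrite mxE [RHS]mxE; apply: eq_bigr => s _.
  by rewrite mulrC [(vec_mx w)^T s b]mxE [R _ _]mxE [V _ _]mxE.
rewrite block_mxEdr.
have [ci co] := @idx_off_start (widen_ord le (rshift n b')) b' erefl.
have [ri ro] := @idx_off_start (widen_ord le (rshift n b)) b erefl.
rewrite RXK_out ?addr0; last by rewrite !negb_and ci ltnn orbT.
by rewrite BJ2 ?ri // !mxE ri ro ci co eqxx /= eq_sym.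
Qed.

Lemma stage_emb B w : size sl = m -> sumn sl = (n + p)%N -> stage i B ->
  stage i.+1 (emb B w) <->
  forall k, \rank (block_mx (bpart B) 0 (vec_mx w *m V) (shift_mx F p) ^+ k) =
    (\sum_(0 <= r < m) (nth 0%N sl r - k))%N.
Proof.
move=> size_l sum_l Bst; have [BJ BJ2 orb] := Bst.
have embE (r c : 'I_N) : emb B w r c = B r c + (R *m (vec_mx w)^T *m K) r c by rewrite mxE.
have le : (n + p <= N)%N by rewrite -startS start_leN.
have trX (M : 'M[F]_(n + p)) k : \rank (M^T ^+ k) = \rank (M ^+ k).
  by rewrite -[RHS]mxrank_tr trmx_expr.
have orbE : orbit_at (start i.+1) sl (emb B w) <->
  forall k, \rank (block_mx (bpart B) 0 (vec_mx w *m V) (shift_mx F p) ^+ k) =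
    (\sum_(0 <= r < m) (nth 0%N sl r - k))%N.
  rewrite startS -size_l; split=> [[le'] /(nilp_orbitP _ sum_l) rk k|rk].
    by rewrite -(emb_block w le') // trX rk.
  by exists le; apply/(nilp_orbitP _ sum_l) => k; rewrite -rk -(emb_block w le) // trX.
rewrite -orbE; split=> [[_ _ orb']|orb']; first by apply: orb'; rewrite leqnn.
split=> [r c ns|r c ic|j /andP[j1]].
- rewrite embE BJ // RXK_out ?addr0 //; apply: contra ns => /and3P[/eqP ci ri ro].
  by rewrite /slice_entry ro ci ri.
- by rewrite embE BJ2 ?RXK_out ?addr0 ?(ltnW ic) // negb_and neq_ltn ic orbT.
rewrite leq_eqVlt => /predU1P[-> //|ji].
apply: orbit_at_eq (orb j _) => [r c rj|]; last by rewrite j1.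
rewrite idx_lt_start => cj; rewrite embE RXK_out ?addr0 // negb_and neq_ltn.
by rewrite (leq_trans cj) // -ltnS.
Qed.

Lemma stage_step d : size sa = m -> size sl = m -> sumn sa = n -> sumn sl = (n + p)%N ->
  (forall j, (nth 0%N sa j <= nth 0%N sl j)%N) ->
  (forall j, (nth 0%N sl j.+1 <= nth 0%N sa j)%N) ->
  rational_chart (stage i) d ->
  let c := (\sum_(0 <= r < m) strip_tail (nth 0%N sa) (nth 0%N sl) m r.+1)%N in
  rational_chart (stage i.+1) (d + (p * i - c)) /\ (c <= p * i)%N.
Proof.
move=> size_a size_l sum_a sum_l al la chart.
apply: (block_step (V := V) size_a size_l sum_a sum_l al la stage_RR stage_KK stage_coord
  (fun B => stage_orbit sum_a) stage_gen stage_ret _ chart) => B w.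
exact: stage_emb.
Qed.

End Step.
End Stages.

(** * Tableaux and the dimension count *)

Section TableauShapes.
Variables (m : nat) (lam mu : seq nat) (tau : seq (seq nat)).
Hypotheses (size_lam : size lam = m) (size_mu : size mu = m).
Hypothesis lam_sorted : sorted geq lam.
Hypothesis tau_ssyt : is_ssyt lam mu tau.

Lemma sorted_nth_anti (s : seq nat) j k :
  sorted geq s -> (j <= k)%N -> (nth 0%N s k <= nth 0%N s j)%N.
Proof.
move=> s_sorted jk; have [ks|sk] := ltnP k (size s); last by rewrite nth_default.
have geq_trans : transitive geq by move=> x y z yx zy; apply: leq_trans zy yx.
have := sorted_leq_nth geq_trans leqnn 0%N s_sorted.
by apply; rewrite ?inE // (leq_ltn_trans jk).
Qed.

Lemma size_tau : size tau = m.
Proof. by case: tau_ssyt => sh _ _ _ _; rewrite -size_lam -sh size_map. Qed.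

Lemma size_tableau_shape i : size (tableau_shape tau i) = m.
Proof. by rewrite !size_map size_tau. Qed.

Lemma nth_tableau_shape i r :
  nth 0%N (tableau_shape tau i) r = count (leq^~ i) (nth [::] tau r).
Proof.
rewrite /tableau_shape /shape -map_comp; have [rt|tr] := ltnP r (size tau).
  by rewrite (nth_map [::]) //= size_filter.
by rewrite !nth_default ?size_map.
Qed.

Lemma sorted_count (s : seq nat) i c : sorted leq s -> (c < size s)%N ->
  (nth 0%N s c <= i)%N = (c < count (leq^~ i) s)%N.
Proof.
elim: s c => // x s IH c /= xs cs; have s_sorted := path_sorted xs.
have [xi|ix] := leqP x i; first by case: c cs => //= c cs; rewrite IH.
have gt y : y \in s -> (i < y)%N.
  by move=> ys; apply: leq_trans ix _; apply: (allP (order_path_min leq_trans xs)).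
have -> : count (leq^~ i) s = 0%N.
  apply/eqP; rewrite -leqn0 leqNgt -has_count; apply/hasPn => y /gt.
  by rewrite -ltnNge.
case: c cs => [_|c cs] /=; first by rewrite leqNgt ix.
by rewrite leqNgt gt // mem_nth.
Qed.

Lemma tableau_shape_leS i r :
  (nth 0%N (tableau_shape tau i) r <= nth 0%N (tableau_shape tau i.+1) r)%N.
Proof. by rewrite !nth_tableau_shape; apply: sub_count => x /= /leqW. Qed.

(** An entry <= i + 1 in row r + 1 has a strictly smaller entry above it, so row r has at least as
    many entries <= i. *)
Lemma tableau_shape_interlace i r :
  (nth 0%N (tableau_shape tau i.+1) r.+1 <= nth 0%N (tableau_shape tau i) r)%N.
Proof.
rewrite !nth_tableau_shape; case: tau_ssyt => sh _ rows cols _.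
have [rt|tr] := ltnP r.+1 (size tau); last by rewrite [nth _ _ r.+1]nth_default.
set s' := nth [::] tau r.+1; set s := nth [::] tau r.
case e: (count _ s') => [//|c].
have cs' : (c < size s')%N by rewrite -e count_size.
have s's : (size s' <= size s)%N.
  have := sorted_nth_anti lam_sorted (leqnSn r); rewrite -sh.
  by rewrite !(nth_map [::]) // ltnW.
have st : s \in tau by rewrite mem_nth // ltnW.
have s't : s' \in tau by rewrite mem_nth.
rewrite -(sorted_count i (rows _ st)) ?(leq_trans cs') //.
rewrite -ltnS; apply: leq_trans (cols r c rt cs') _.
by rewrite (sorted_count _ (rows _ s't)) // e.
Qed.

Lemma sum_tableau_shape i : (i <= m)%N -> sumn (tableau_shape tau i) = sumn (take i mu).
Proof.
case: tau_ssyt => _ range _ _ cnt.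
have -> : sumn (tableau_shape tau i) = count (leq^~ i) (flatten tau).
  rewrite count_flatten /tableau_shape /shape -map_comp.
  by congr sumn; apply: eq_map => row /=; rewrite size_filter.
elim: i => [_|i IH im].
  rewrite take0 /=; apply/eqP; rewrite -leqn0 leqNgt -has_count.
  apply/hasPn => x /flattenP [row rt xr] /=.
  by have /andP[x1 _] := range _ _ rt xr; rewrite -ltnNge.
rewrite (take_nth 0%N) ?size_mu // sumn_rcons -IH ?(ltnW im) //.
have <- : count_mem i.+1 (flatten tau) = nth 0%N mu i by rewrite cnt ?size_mu.
rewrite -count_predUI [count (predI _ _) _](_ : _ = 0%N) ?addn0.
  by apply: eq_count => x /=; rewrite leq_eqVlt orbC.
apply/eqP; rewrite -leqn0 leqNgt -has_count; apply/hasPn => x _ /=.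
by case: eqP => [->|_]; rewrite ?ltnn ?andbF.
Qed.

Lemma tableau_shape_size : tableau_shape tau m = lam.
Proof.
case: tau_ssyt => <- range _ _ _; rewrite /tableau_shape /shape -map_comp.
apply/eq_in_map => row rt /=; congr size; apply/all_filterP/allP => x xr.
by have /andP[_] := range _ _ rt xr; rewrite size_mu.
Qed.

End TableauShapes.

(** A box of the strip in row j is counted in b_r once for each r < j; this turns the sum of the b_r
    into a weighted sum that telescopes over the stages. *)
Lemma sum_nat_tails (f : nat -> nat) m :
  (\sum_(0 <= r < m) \sum_(r.+1 <= j < m) f j = \sum_(0 <= j < m) j * f j)%N.
Proof.
elim: m => [|m IH]; first by rewrite !big_geq.
rewrite [LHS]big_nat_recr //= [RHS]big_nat_recr //= -IH [X in (_ + X)%N = _]big_geq // addn0.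
rewrite (eq_big_nat _ _ (F2 := fun r => \sum_(r.+1 <= j < m) f j + f m)%N).
  by rewrite big_split /= sum_nat_const_nat subn0.
by move=> r /andP[_ rm]; rewrite big_nat_recr.
Qed.

Lemma chart_X_circ (F : numFieldType) (N m : nat) (lam mu : m.-tuple nat)
    (tau : seq (seq nat)) :
  is_partition N lam -> is_partition N mu -> (forall k : 'I_m, (0 < tnth mu k)%N) ->
  is_ssyt lam mu tau ->
  exists d, rational_chart (X_circ mu tau : set 'M[F]_N) d /\ d%:Z = pairing_rho lam mu.
Proof.
move=> [lam_s lam_N] [mu_s mu_N] mu_pos' tauP.
have size_lam := size_tuple lam; have size_mu := size_tuple mu.
have mu_anti j k := @sorted_nth_anti mu j k mu_s.
have mu_pos k : (k < m)%N -> (0 < nth 0%N mu k)%N.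
  by move=> km; have := mu_pos' (Ordinal km); rewrite (tnth_nth 0%N).
pose sh i := nth 0%N (tableau_shape tau i).
have size_sh := size_tableau_shape size_lam tauP.
have [d [dX dE]] : exists d, rational_chart (@stage F N mu tau m) d /\
    (d + \sum_(0 <= r < m) r * sh m r = \sum_(0 <= s < m) s * nth 0%N mu s)%N.
  (* The invariant is additive to stay within natural numbers. Stage s adds s mu_s minus the sum of
     the r (l_r - a_r) to the dimension, and the subtracted terms telescope. *)
  suff H i : (i <= m)%N -> exists d, rational_chart (@stage F N mu tau i) d /\
      (d + \sum_(0 <= r < m) r * sh i r = \sum_(0 <= s < i) s * nth 0%N mu s)%N by exact: H.
  elim: i => [_|i IH im].
    exists 0%N; split; first exact: chart_stage0.
    rewrite [RHS]big_geq // add0n big_nat big1 // => r /andP[_ rm].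
    have := sum_tableau_shape size_mu tauP (leq0n m); rewrite take0 sumn_nth size_sh.
    rewrite big_mkord (bigD1 (Ordinal rm)) //= => /eqP; rewrite addn_eq0 => /andP[/eqP s0 _].
    by rewrite /sh s0 muln0.
  have [d [dc dE]] := IH (ltnW im).
  have sa := sum_tableau_shape size_mu tauP (ltnW im).
  have sl := sum_tableau_shape size_mu tauP im; rewrite startS in sl.
  have [] := stage_step size_mu mu_N mu_pos im (size_sh i) (size_sh i.+1) sa sl
    (tableau_shape_leS tau i) (tableau_shape_interlace lam_s tauP i) dc.
  rewrite sum_nat_tails; set c := (\sum_(0 <= j < m) _)%N => dc' cle.
  exists (d + (nth 0%N mu i * i - c))%N; split=> //.
  have -> : (\sum_(0 <= r < m) r * sh i.+1 r = \sum_(0 <= r < m) r * sh i r + c)%N.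
    rewrite /c -big_split /=; apply: eq_bigr => r _; rewrite -mulnDr subnKC //.
    exact: tableau_shape_leS.
  by rewrite big_nat_recr //= -dE (mulnC i); lia.
rewrite (stage_X_circ F tau size_mu mu_N mu_anti) in dX.
exists d; split=> //; apply: (addIr (\sum_(0 <= r < m) r * sh m r)%N%:Z).
rewrite -PoszD dE /sh (tableau_shape_size size_mu tauP) /pairing_rho.
have natZ (f : nat -> nat) : (\sum_(0 <= r < m) f r)%N%:Z = \sum_(r < m) (f r)%:Z.
  by rewrite big_mkord -[LHS]/(_%:Z) -natz natr_sum; apply: eq_bigr => r _; rewrite natz.
have tot (s : m.-tuple nat) : sumn s = N -> \sum_(k < m) (nth 0%N s k)%:Z = N%:Z.
  by move=> <-; rewrite sumn_nth size_tuple natZ.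
rewrite !natZ -big_split /=.
(* Splitting the weight m - k, the terms with m cancel because both partitions have sum [N]. *)
rewrite [RHS](_ : _ = \sum_(k < m) ((nth 0%N lam k)%:Z * m%:Z)
  - \sum_(k < m) ((nth 0%N mu k)%:Z * m%:Z)
  + \sum_(k < m) (k * nth 0%N mu k)%N%:Z).
  by rewrite -!mulr_suml !tot // subrr add0r.
rewrite -sumrB -big_split /=; apply: eq_bigr => k _; rewrite !(tnth_nth 0%N).
rewrite -subzn; last exact: ltnW.
by rewrite !PoszM; ring.
Qed.

Theorem mainTheorem4 (R : realType) (N m : nat) (lam mu : m.-tuple nat)
    (tau : seq (seq nat))
    (hm : (1 <= m)%N) (hN : (m <= N)%N)
    (hlam : is_partition N lam)
    (hmu : is_partition N mu) (hmu_pos : forall k : 'I_m, (0 < tnth mu k)%N)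
    (htau : is_ssyt lam mu tau) :
  exists (Xtop : set 'M[R[i]]_N) (d : nat),
    [/\ irreducible_component (X_circ mu tau) Xtop,
        has_krull_dim Xtop d,
        d%:Z = pairing_rho lam mu
      & forall Z : set 'M[R[i]]_N,
          irreducible_component (X_circ mu tau) Z -> Z <> Xtop ->
          exists2 e : nat, has_krull_dim Z e & (e < d)%N].
Proof.
have [d [dX dE]] := chart_X_circ (R[i] : numFieldType) hlam hmu hmu_pos htau.
have irrX := chart_irreducible dX.
(* [X_circ] is irreducible, hence its own only component, and no component [Z] different from it
   exists. *)
exists (X_circ mu tau), d; split=> //.
- by split=> // Y YX _ XY; apply/seteqP.
- exact: chart_krull_dim.
by move=> Z [ZX _ Zmax] ZneX; case: ZneX; rewrite (Zmax _ _ irrX ZX).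
Qed.
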